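(* Let $K\subset\mathbb{R}^n$ be a convex body. Then, for $-1<p<q<\infty$, $$(DK)^\circ=Z_\infty^\circ K\subset Z_q^\circ K\subset Z_p^\circ K\subset Z_{-1}^\circ K=\mathbb{R}^n.$$ Additionally, the map $p\mapsto Z_p^\circ K$ is continuous in the Hausdorff metric for $p>-1$.
   Context: A convex body is a compact convex set with non-empty interior. The radial function of a star-shaped set $M$ (a set containing $0$ and, with each point $x$, the segment $[0,x]$) is $\rho_M(\theta)=\sup\{t>0:t\theta\in M\}$, $\theta\in\mathbb{S}^{n-1}$; a star body is a star-shaped compact set with finite, positive, continuous radial function. $DK=\{x\in\mathbb{R}^n:K\cap(K+x)\neq\emptyset\}$ is the difference body, and its polar $(DK)^\circ$ has radial function $(\max_{x\in DK}|\langle x,\cdot\rangle|)^{-1}$. The covariogram is $g_K(x)=\mathrm{Vol}_n(K\cap(K+x))$, whose support is $DK$. For $p>0$, $R_pK$ is the star body with $\rho_{R_pK}(\theta)=\left(p\int_0^\infty\frac{g_K(r\theta)}{\mathrm{Vol}_n(K)}r^{p-1}dr\right)^{1/p}$; for $p=0$, $\rho_{R_0K}(\theta)=\exp\left(\int_0^\infty\frac{\partial}{\partial r}\left(\frac{-g_K(r\theta)}{\mathrm{Vol}_n(K)}\right)\log(r)dr\right)$; for $p\in(-1,0)$, $\rho_{R_pK}(\theta)=\left(p\int_0^\infty\left(\frac{g_K(r\theta)}{\mathrm{Vol}_n(K)}-1\right)r^{p-1}dr\right)^{1/p}$. For $q>-1$, $q\ne0$, and a star body $M$, $\Gamma_q^\circ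 M$ is the star body with $\rho_{\Gamma_q^\circ M}(u)=\left(\frac{1}{\mathrm{Vol}_n(M)}\int_M|\langle x,u\rangle|^qdx\right)^{-1/q}$. The polar $q$th mean zonoid of $K$ is, for $q>-1$, $q\neq0$, $Z_q^\circ K=\left(\frac{\mathrm{Vol}_n(K)}{\mathrm{Vol}_n(R_{n+q}K)}\right)^{1/q}\Gamma_q^\circ(R_{n+q}K)$; equivalently $\rho_{Z_q^\circ K}(\theta)=\left(\frac{1}{\mathrm{Vol}_n(K)^2}\int_{\mathbb{R}^n}|\langle\theta,z\rangle|^qg_K(z)dz\right)^{-1/q}$. For $q=0$, $\rho_{Z_0^\circ K}(\theta)=\exp\left(-\frac{1}{\mathrm{Vol}_n(K)^2}\int_{\mathbb{R}^n}\log|\langle\theta,z\rangle|\,g_K(z)dz\right)$. The sets $Z_\infty^\circ K$ and $Z_{-1}^\circ K$ are the star-shaped sets whose radial functions are the pointwise limits of $\rho_{Z_q^\circ K}$ as $q\to\infty$ and $q\to(-1)^+$ respectively. *)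

(* Defs.v *)
From HB Require Import structures.
From mathcomp Require Import all_boot all_order all_algebra.
From mathcomp Require Import all_classical all_reals all_analysis.

Set Implicit Arguments.
Unset Strict Implicit.
Unset Printing Implicit Defensive.

Import Order.TTheory GRing.Theory Num.Theory.
Import numFieldNormedType.Exports.

Local Open Scope classical_set_scope.
Local Open Scope ring_scope.

Fact rV_display : measure_display. Proof. exact: default_measure_display. Qed.

Section rV_measurable.
Context (R : realType) (n : nat).

(** Generated by the coordinate functions; on R^n this is the Borel
    sigma-algebra. *)
Definition rV_cylinders : set_system 'rV[R]_n :=
  [set A | exists i (B : set (measurableTypeR R)),
     measurable B /\ A = [set x : 'rV[R]_n | B (x ord0 i)]].

Let cylinders_set0 : <<s rV_cylinders >> set0.
Proof. exact: sigma_algebra0. Qed.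

Let cylinders_setC A : <<s rV_cylinders >> A -> <<s rV_cylinders >> (~` A).
Proof. exact: sigma_algebraC. Qed.

Let cylinders_bigcup (F : (set 'rV[R]_n)^nat) :
  (forall i, <<s rV_cylinders >> (F i)) ->
  <<s rV_cylinders >> (\bigcup_i F i).
Proof. exact: sigma_algebra_bigcup. Qed.

HB.instance Definition _ := @isMeasurable.Build rV_display 'rV[R]_n
  <<s rV_cylinders >> cylinders_set0 cylinders_setC cylinders_bigcup.

Lemma measurable_rV_coord (i : 'I_n) :
  measurable_fun setT (fun x : 'rV[R]_n => x ord0 i : measurableTypeR R).
Proof.
by move=> _ B mB; rewrite setTI; apply: sub_sigma_algebra; exists i, B.
Qed.

Lemma measurable_fun_rVP d (T : measurableType d) (f : T -> 'rV[R]_n) :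
  (forall i, measurable_fun setT (fun t => f t ord0 i : measurableTypeR R)) ->
  measurable_fun setT f.
Proof.
move=> mf _ A mA.
suff : <<s rV_cylinders >> `<=` [set A | measurable (setT `&` f @^-1` A)].
  exact.
apply: smallest_sub.
  split => /=.
  - by rewrite preimage_set0 setI0; exact: measurable0.
  - move=> C; rewrite !setTI setTD => mC.
    by rewrite preimage_setC; exact: measurableC.
  - move=> F mF; rewrite setTI preimage_bigcup; apply: bigcupT_measurable => k.
    by rewrite -[X in measurable X]setTI; exact: mF.
by move=> _ [i [B [mB ->]]] /=; exact: (mf i measurableT B mB).
Qed.

End rV_measurable.

Section rV_lebesgue_measure.
Context (R : realType).
Local Open Scope ereal_scope.

Definition rV_cons n (z : measurableTypeR R * 'rV[R]_n) : 'rV[R]_n.+1 :=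
  row_mx (z.1%:M : 'rV[R]_1) z.2.

Lemma rV_cons0 n z : @rV_cons n z ord0 ord0 = z.1.
Proof.
rewrite /rV_cons (_ : ord0 = lshift n (ord0 : 'I_1)); last exact/val_inj.
by rewrite (@row_mxEl _ 1 1 n) mxE eqxx mulr1n.
Qed.

Lemma rV_consS n z (j : 'I_n) : rV_cons z ord0 (lift ord0 j) = z.2 ord0 j.
Proof.
rewrite /rV_cons (_ : lift ord0 j = rshift 1 j); last exact/val_inj.
by rewrite (@row_mxEr _ 1 1 n).
Qed.

Lemma measurable_rV_cons n : measurable_fun setT (@rV_cons n).
Proof.
apply: measurable_fun_rVP => i; have [j ->|->] := unliftP ord0 i.
- rewrite (_ : (fun _ => _) = (fun y : 'rV[R]_n => y ord0 j) \o snd).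
    by apply: measurableT_comp => //; exact: measurable_rV_coord.
  by apply/funext => z /=; rewrite rV_consS.
- rewrite (_ : (fun _ => _) = fst); first exact: measurable_fst.
  by apply/funext => z /=; rewrite rV_cons0.
Qed.

Section step.
Context (n : nat) (m : {sigma_finite_measure set 'rV[R]_n -> \bar R}).

Definition rV_measureS : set 'rV[R]_n.+1 -> \bar R :=
  pushforward (lebesgue_measure \x m) (@rV_cons n).

Let rV_measureS0 : rV_measureS set0 = 0.
Proof. by rewrite /rV_measureS /pushforward preimage_set0 measure0. Qed.

Let rV_measureS_ge0 A : 0 <= rV_measureS A.
Proof. by rewrite /rV_measureS /pushforward; exact: measure_ge0. Qed.

Let rV_measureS_sigma_additive : semi_sigma_additive rV_measureS.
Proof.
move=> F mF tF mUF; rewrite /rV_measureS /pushforward preimage_bigcup.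
apply: measure_semi_sigma_additive.
- by move=> k; rewrite -[X in measurable X]setTI; exact: measurable_rV_cons.
- apply/trivIsetP => /= i j _ _ ij; rewrite -preimage_setI.
  by move/trivIsetP : tF => /(_ _ _ _ _ ij) ->//; rewrite preimage_set0.
- rewrite -preimage_bigcup -[X in measurable X]setTI.
  exact: measurable_rV_cons.
Qed.

HB.instance Definition _ := isMeasure.Build _ _ _ rV_measureS
  rV_measureS0 rV_measureS_ge0 rV_measureS_sigma_additive.

Let uncons (x : 'rV[R]_n.+1) : measurableTypeR R * 'rV[R]_n :=
  (x ord0 ord0, \row_j x ord0 (lift ord0 j)).

Let consK z : uncons (rV_cons z) = z.
Proof.
case: z => a b; rewrite /uncons rV_cons0; congr (_, _).
by apply/rowP => j; rewrite mxE rV_consS.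
Qed.

Let measurable_uncons : measurable_fun setT uncons.
Proof.
apply/measurable_fun_pairP; split; first exact: measurable_rV_coord.
apply: measurable_fun_rVP => i.
rewrite (_ : (fun _ => _) = (fun x : 'rV[R]_n.+1 => x ord0 (lift ord0 i))).
  exact: measurable_rV_coord.
by apply/funext => x /=; rewrite mxE.
Qed.

Let rV_measureS_sigma_finite : sigma_finite setT rV_measureS.
Proof.
have /sigma_finiteP[F [TF ndF Foo]] := sigma_finiteT (@lebesgue_measure R).
have /sigma_finiteP[G [TG ndG Goo]] := sigma_finiteT m.
exists (fun k => uncons @^-1` (F k `*` G k)).
  rewrite -preimage_bigcup; apply/esym/seteqP; split => // x _.
  have [i _ Fi] : (\bigcup_i F i) (uncons x).1 by rewrite -TF.
  have [j _ Gj] : (\bigcup_i G i) (uncons x).2 by rewrite -TG.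
  exists (maxn i j) => //; split.
  - by move: Fi; exact/subsetPset/ndF/leq_maxl.
  - by move: Gj; exact/subsetPset/ndG/leq_maxr.
move=> k; have [mF Flty] := Foo k; have [mG Glty] := Goo k; split.
  rewrite -[X in measurable X]setTI; apply: measurable_uncons => //.
  exact: measurableX.
rewrite /rV_measureS /pushforward -comp_preimage.
rewrite (_ : uncons \o _ = id); last by apply/funext => z /=; rewrite consK.
by rewrite preimage_id product_measure1E// lte_mul_pinfty// ge0_fin_numE.
Qed.

HB.instance Definition _ := Measure_isSigmaFinite.Build _ _ _ rV_measureS
  rV_measureS_sigma_finite.

End step.

(** Lebesgue measure on R^n; see [rV_lebesgue_box]. *)
Fixpoint rV_lebesgue n : {sigma_finite_measure set 'rV[R]_n -> \bar R} :=
  match n with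
  | 0 => @dirac _ _ (0%R : 'rV[R]_0) R
  | n'.+1 => rV_measureS (rV_lebesgue n')
  end.

Lemma rV_lebesgue_box n (A : 'I_n -> set (measurableTypeR R)) :
  (forall i, measurable (A i)) ->
  rV_lebesgue n [set x : 'rV[R]_n | forall i, A i (x ord0 i)] =
  \prod_(i < n) lebesgue_measure (A i).
Proof.
elim: n A => [|n ih] A mA /=.
  rewrite big_ord0 diracE mem_set// => -[].
  by [].
rewrite big_ord_recl -ih; last by move=> i; exact: mA.
have mP :
    measurable [set x : 'rV[R]_n | forall i, A (lift ord0 i) (x ord0 i)].
  rewrite (_ : mkset _ = \bigcap_(i in [set: 'I_n])
    [set x : 'rV[R]_n | A (lift ord0 i) (x ord0 i)]); last first.
    by apply/seteqP; split => [x xA i _|x xA i]; exact: xA.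
  apply: fin_bigcap_measurable => [|i _]; first exact: finite_finset.
  rewrite -[X in measurable X]setTI.
  by have := @measurable_rV_coord R n i measurableT _ (mA (lift ord0 i)).
rewrite -product_measure1E//.
rewrite /rV_measureS /pushforward; congr (_ _).
apply/seteqP; split => -[a b] /=.
- move=> h; split; first by have := h ord0; rewrite rV_cons0.
  by move=> i; have := h (lift ord0 i); rewrite rV_consS.
- move=> [h0 h] i; have [j ->|->] := unliftP ord0 i.
    by rewrite rV_consS; exact: h.
  by rewrite rV_cons0.
Qed.

End rV_lebesgue_measure.

Section euclidean.
Context (R : realType) (n : nat).
Implicit Types (x y u : 'rV[R]_n) (A B : set 'rV[R]_n).

Definition dotp x y : R := \sum_(i < n) x ord0 i * y ord0 i.

(** The library norm on ['rV[R]_n] is the sup norm; it induces the same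
    topology as this one. *)
Definition enorm x : R := Num.sqrt (dotp x x).

Definition usphere : set 'rV[R]_n := [set u | enorm u = 1].

Definition polar A : set 'rV[R]_n :=
  [set y | forall x, A x -> dotp x y <= 1].

(** Meaningful for nonempty compact sets; [+oo] when no radius works. *)
Definition hausdorff_dist A B : \bar R :=
  ereal_inf [set e%:E | e in [set e : R |
    [/\ 0 <= e,
        forall x, A x -> exists2 y, B y & enorm (x - y) <= e
      & forall y, B y -> exists2 x, A x & enorm (x - y) <= e]]].

End euclidean.

Section star_shaped.
Context (R : realType) (n : nat).
Implicit Types (M : set 'rV[R]_n) (rho : 'rV[R]_n -> \bar R).

Definition radial M (u : 'rV[R]_n) : \bar R :=
  ereal_sup [set t%:E | t in [set t : R | 0 < t /\ M (t *: u)]].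

(** The star-shaped set with radial function [rho], closed along each ray.
    Only the values of [rho] on the unit sphere matter; [+oo] is allowed. *)
Definition star_of rho : set 'rV[R]_n :=
  [set x | exists (t : R) (u : 'rV[R]_n),
     [/\ usphere u, 0 <= t, (t%:E <= rho u)%E & x = t *: u]].

End star_shaped.

Section mean_zonoids.
Context (R : realType) (n : nat).
Implicit Types (K M : set 'rV[R]_n) (x u : 'rV[R]_n) (p q : R).

Definition convex_body K : Prop :=
  [/\ compact K, convex_set K & interior K !=set0].

Definition vol M : R := fine (rV_lebesgue R n M).

Definition translate K x : set 'rV[R]_n := [set y + x | y in K].

Definition diff_body K : set 'rV[R]_n :=
  [set x | K `&` translate K x !=set0].

Definition covariogram K x : R := vol (K `&` translate K x).

(** [R_p K] for [p > 0]; it is only used with [p = n + q > 0]. *)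
Definition radial_mean_body p K : set 'rV[R]_n :=
  star_of (fun u =>
    ((p * \int[lebesgue_measure]_(r in `]0, +oo[)
        (covariogram K (r *: u) / vol K * r `^ (p - 1))) `^ p^-1)%:E).

(** [Gamma_q^o M] for [q > -1], [q != 0]. For [q < 0] the integrand takes the
    value [0 `^ q = 0] on the hyperplane orthogonal to [u], a null set. *)
Definition polar_centroid_body q M : set 'rV[R]_n :=
  star_of (fun u =>
    (((vol M)^-1 * \int[rV_lebesgue R n]_(x in M) `|dotp x u| `^ q)
       `^ (- q^-1))%:E).

(** [Z_q^o K] for [q > -1]. In the case [q = 0], [ln 0 = 0], again on a null
    set. *)
Definition polar_mean_zonoid q K : set 'rV[R]_n :=
  if q == 0 then
    star_of (fun u =>
      (expR (- ((vol K ^+ 2)^-1 *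
        \int[rV_lebesgue R n]_z (ln `|dotp u z| * covariogram K z))))%:E)
  else
    let S := radial_mean_body (n%:R + q) K in
    [set ((vol K / vol S) `^ q^-1) *: x | x in polar_centroid_body q S].

(** The radial functions are nonincreasing in [q], so the two limits below
    exist in [\bar R]. *)
Definition polar_mean_zonoid_pinfty K : set 'rV[R]_n :=
  star_of (fun u => lim (radial (polar_mean_zonoid q K) u @[q --> +oo])).

Definition polar_mean_zonoid_m1 K : set 'rV[R]_n :=
  star_of (fun u => lim (radial (polar_mean_zonoid q K) u @[q --> (-1)^'+])).

End mean_zonoids.

(* Main.v *)
Require Import Defs.
From mathcomp Require Import all_boot all_order all_algebra.
From mathcomp Require Import all_classical all_reals all_analysis.
From mathcomp Require Import measurable_realfun lra ring.

(** Let [w = g_K / vol(K)^2], a probability density on [R^n], and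
    [X_u(z) = |<z, u>|]. A polar-coordinate computation identifies the radial
    function of [Z_q^o K] with [exp(- L_u(q))], where
    [L_u(q) = (ln E_w[X_u^q]) / q] and [L_u(0) = E_w[ln X_u]].

    The Box-Cox functions [phi_q(t) = (e^(q t) - 1) / q], [phi_0(t) = t], are
    nondecreasing in [q] and satisfy
    [E_w[phi_q(ln X_u - s)] = phi_q(L_u(q) - s)] for all [s]. Taking
    [s = L_u(q)] gives the monotonicity of [L_u] (hence the inclusions), and a
    local Lipschitz bound on [q |-> phi_q] makes [L_u] locally Lipschitz in
    [q], uniformly in [u], because [sup_u E_w[X_u^a]] is finite for [a > -1]:
    the law of [<z, u>] under [w] is dominated by a multiple of Lebesgue measure
    on an interval. It also dominates a multiple of Lebesgue measure near [0],
    so that [E_w[X_u^q] -> +oo] as [q -> -1]. Finally [L_u(q)] tends to the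
    logarithm of the essential supremum of [X_u] as [q -> +oo]; by convexity
    [g_K] is bounded below near every point [(1 - l) *: z] with [z] in [DK] and
    [0 < l], so this supremum is the support function of [DK]. *)

Import Order.TTheory GRing.Theory Num.Theory.
Import numFieldNormedType.Exports.

Local Open Scope classical_set_scope.
Local Open Scope ring_scope.

Set Implicit Arguments.
Unset Strict Implicit.
Unset Printing Implicit Defensive.

(** No measure on the sphere is constructed. The integral of a [q]-homogeneous function over
    [R_(n+q) K] equals its integral against [g_K / vol K]: averaging over dilates of a shell reduces
    both to radial moments, and these agree by the definition of [R_(n+q) K]. The volume of that
    body then cancels from the definition of [Z_q^o K]. Working with [exp (q * Y)],
    [Y = ln |<z, u>|], puts [q = 0] on the same footing as the other exponents. The price is that
    [powR 0 q = 0] and [ln 0 = 0] disagree on the hyperplane orthogonal to [u], which has to be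
    shown null for the weight. The Hausdorff distance compares all directions at once, so upper
    estimates need constants independent of [u]. They come from a cube containing [DK] and from the
    fact that a unit vector has a coordinate of modulus at least [1 / n]. The lower estimates, used
    for the blow-up at [-1] and for the limit at [+oo], are pointwise in [u], and their constants
    may depend on it. *)

(** * Affine substitutions on the real line *)

Section lebesgue_affine.
Context {R : realType}.
Local Notation mu := (@lebesgue_measure R).
Local Notation TR := (measurableTypeR R).

Lemma measurable_affine (c u : R) :
  measurable_fun setT (fun t : TR => (c + u * t) : TR).
Proof. by apply: measurable_funD => //; exact: measurable_funM. Qed.

(** The pushforward rescaled by [u] gives each interval its length, so uniqueness of Lebesgue
    measure identifies it with [mu]. *)
Lemma lebesgue_measure_affine (c u : R) (A : set TR) : 0 < u -> measurable A ->
  pushforward mu (fun t : TR => (c + u * t) : TR) A = ((u^-1)%:E * mu A)%E.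
Proof.
move=> u0 mA.
have : mu A =
    pushforward (mscale (NngNum (ltW u0)) mu) (fun t : TR => (c + u * t) : TR) A.
  apply: lebesgue_measure_unique => // [|mf _ [[a b]] _ <-].
    exact: measurable_affine.
  pose I := `](a - c) / u, (b - c) / u]%classic.
  transitivity (u%:E * mu I)%E.
    rewrite !lebesgue_measure_itv/= !lte_fin ltr_pM2r ?invr_gt0// ltrD2r.
    case: ifPn => _; last by rewrite mule0.
    by rewrite -!EFinB -EFinM; congr (_%:E); field; rewrite gt_eqF.
  congr (_ * mu _)%E; rewrite /I; apply/seteqP; split => t /=;
    by rewrite !in_itv/= ltr_pdivrMr// ler_pdivlMr// ltrBlDl lerBrDl (mulrC t).
move=> ->; rewrite -[pushforward (mscale _ _) _ _]/(u%:E *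
  mu ((fun t : TR => (c + u * t)%R : TR) @^-1` A))%E.
by rewrite muleA -EFinM mulVf ?gt_eqF// mul1e.
Qed.

Lemma ge0_integral_affine_gt0 (c u : R) (h : R -> \bar R) : 0 < u ->
  measurable_fun setT h -> (forall t, 0 <= h t)%E ->
  (\int[mu]_t h (c + u * t)%R = (u^-1)%:E * \int[mu]_t h t)%E.
Proof.
move=> u0 mh h0.
have mf := measurable_affine c u.
rewrite -[LHS](_ : (\int[pushforward mu (fun t : TR => (c + u * t)%R : TR)]_t h t)%E = _);
  last by rewrite ge0_integral_pushforward.
have ui : 0 <= u^-1 by rewrite invr_ge0 ltW.
rewrite -[RHS](_ : (\int[mscale (NngNum ui) mu]_t h t)%E = _); last first.
  by rewrite ge0_integral_mscale.
apply: eq_measure_integral => //= A mA _.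
by rewrite lebesgue_measure_affine.
Qed.

Lemma ge0_integral_oppT (h : R -> \bar R) :
  measurable_fun setT h -> (forall t, 0 <= h t)%E ->
  (\int[mu]_t h (- t)%R = \int[mu]_t h t)%E.
Proof.
move=> mh h0.
rewrite -[LHS](_ : (\int[pushforward mu (-%R : TR -> TR)]_t h t)%E = _);
  last by rewrite ge0_integral_pushforward.
by apply: eq_measure_integral => //= A mA _; rewrite lebesgue_measureN.
Qed.

Lemma ge0_integral_affine (c u : R) (h : R -> \bar R) : u != 0 ->
  measurable_fun setT h -> (forall t, 0 <= h t)%E ->
  (\int[mu]_t h (c + u * t)%R = (`|u|^-1)%:E * \int[mu]_t h t)%E.
Proof.
move=> u0 mh h0.
have mhc (v : R) : measurable_fun setT (fun t : R => h (c + v * t)).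
  by apply: (measurableT_comp mh); exact: measurable_affine.
have [u_lt0|u_gt0|u00] := ltgtP u 0.
- rewrite ltr0_norm// -(@ge0_integral_affine_gt0 c) ?oppr_gt0//.
  rewrite -[LHS]ge0_integral_oppT//.
  by apply: eq_integral => t _; rewrite mulrN mulNr.
- by rewrite gtr0_norm// ge0_integral_affine_gt0.
- by rewrite u00 eqxx in u0.
Qed.

End lebesgue_affine.

(** * Integrals of powers near the origin *)

Section powR_integral.
Context {R : realType}.
Local Notation mu := (@lebesgue_measure R).

Lemma continuous_powR (a x : R) : 0 < x -> {for x, continuous (@powR R ^~ a)}.
Proof.
move=> x0; apply/differentiable_continuous/derivable1_diffP/derivable_powR.
by rewrite in_itv/= x0.
Qed.

Lemma integral_powR_itvcc (a e D : R) : 0 < a -> 0 < e -> e < D ->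
  (\int[mu]_(t in `[e, D]) (t `^ (a - 1))%:E
    = (a^-1 * D `^ a)%:E - (a^-1 * e `^ a)%:E)%E.
Proof.
move=> a0 e0 eD.
have d (x : R) : 0 < x -> derivable (fun y : R => a^-1 * y `^ a) x 1.
  move=> x0; apply: derivableM => //; apply: derivable_powR.
  by rewrite in_itv/= x0.
have c (x : R) : 0 < x -> {for x, continuous (fun y : R => a^-1 * y `^ a)}.
  by move=> x0; apply/differentiable_continuous/derivable1_diffP/d.
apply: (continuous_FTC2 (F := fun y : R => a^-1 * y `^ a) eD).
- apply: continuous_in_subspaceT => x; rewrite inE/= in_itv/= => /andP[ex _].
  exact/continuous_powR/(lt_le_trans e0).
- split.
  + by move=> x; rewrite in_itv/= => /andP[ex _]; apply/d/(lt_trans e0).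
  + exact/cvg_at_right_filter/c.
  + exact/cvg_at_left_filter/c/(lt_trans e0).
- move=> x; rewrite in_itv/= => /andP[ex _].
  have x0 := lt_trans e0 ex.
  rewrite derive1E deriveZ/=; last by apply: derivable_powR; rewrite in_itv/= x0.
  rewrite -derive1E powR_derive1 ?in_itv/= ?x0//.
  by rewrite /GRing.scale/= mulrA mulVf ?gt_eqF// mul1r.
Qed.

(** For [a < 1] the integrand is unbounded at [0], so the fundamental theorem is applied on [[e, D]]
    only and the left end is sent to [0] by monotone convergence. *)
Lemma integral_powR_itv0c (a D : R) : 0 < a -> 0 <= D ->
  (\int[mu]_(t in `]0%R, D]) (t `^ (a - 1))%:E = (a^-1 * D `^ a)%:E)%E.
Proof.
move=> a0; rewrite le_eqVlt => /predU1P[<-|D0].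
  by rewrite set_itv_ge ?bnd_simp ?ltxx// integral_set0 powR0 ?gt_eqF// mulr0.
(* Starting the denominators at [2] keeps [e k < D], as the formula on closed intervals requires. *)
pose e (k : nat) : R := D / k.+2%:R.
have e0 k : 0 < e k by rewrite divr_gt0.
have eD k : e k < D by rewrite ltr_pdivrMr// ltr_pMr// ltr1n.
pose F k : set R := `[e k, D]%classic.
have -> : `]0, D]%classic = \bigcup_k F k.
  apply/seteqP; split => x /=; rewrite in_itv/=.
    move=> /andP[x0 xD].
    exists (Num.truncn (D / x)) => //; rewrite /F/= in_itv/= xD andbT /e.
    rewrite ler_pdivrMr// mulrC -ler_pdivrMr//.
    have := truncnS_gt (D / x).
    by move=> /ltW /le_trans; apply; rewrite ler_nat.
  move=> [k _]; rewrite /F/= in_itv/= => /andP[+ ->]; rewrite andbT.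
  exact: lt_le_trans.
rewrite -[LHS](@cvg_lim _ _ _ \oo _
  (fun k => \int[mu]_(t in F k) (t `^ (a - 1))%:E)%E) //; last first.
  apply: ge0_nondecreasing_set_cvg_integral => //.
  - move=> m k mk; rewrite subsetEset /F; apply: subset_itvr.
    by rewrite bnd_simp /e ler_pM2l// lef_pV2 ?posrE// ler_nat !ltnS.
  - by move=> k; exact: measurable_itv.
  - move=> k; apply/measurable_EFinP.
    by apply: measurable_funTS; exact: measurable_powR.
  - by move=> k x _; rewrite lee_fin powR_ge0.
apply: cvg_lim => //.
have -> : (fun k => \int[mu]_(t in F k) (t `^ (a - 1))%:E)%E =
    (fun k => ((a^-1 * D `^ a) - (a^-1 * e k `^ a))%:E).
  by apply/funext => k; rewrite integral_powR_itvcc.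
apply: cvg_EFin; first exact: nearW.
rewrite -[X in _ --> X]subr0; apply: cvgB; first exact: cvg_cst.
rewrite -(mulr0 a^-1); apply: cvgM; first exact: cvg_cst.
have ecvg : e k @[k --> \oo] --> (0 : R).
  rewrite -(mulr0 D); apply: cvgM; first exact: cvg_cst.
  by have := @cvg_harmonic R; rewrite -cvg_shiftS.
(* The limit of the power at [0] is one-sided; positivity of [e k] supplies the side. *)
apply: (cvg_comp (G := 0^'+) e (@powR R ^~ a)); last exact: powR_cvg0.
move=> A [/= d d0 dA]; near=> k; apply: dA => //=.
by near: k; apply: cvgr_dist_lt.
Unshelve. all: by end_near. Qed.

End powR_integral.

(** * Borel sets and measurable functions on row vectors *)

Section rV_measurability.
Context {R : realType}.

Lemma measurable_fun_rV_coord d (T : measurableType d) n (f : T -> 'rV[R]_n)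
    (D : set T) (i : 'I_n) :
  measurable_fun D f -> measurable_fun D (fun t => f t ord0 i : R).
Proof. by move=> mf; apply: (measurableT_comp (@measurable_rV_coord R n i)). Qed.

Lemma measurable_fun_rVD d (T : measurableType d) n (f g : T -> 'rV[R]_n) :
  measurable_fun setT f -> measurable_fun setT g ->
  measurable_fun setT (fun t => f t + g t).
Proof.
move=> mf mg; apply: measurable_fun_rVP => i.
rewrite (_ : (fun _ => _) = (fun t => (f t ord0 i : R) + g t ord0 i)).
  by apply: measurable_funD; exact: measurable_fun_rV_coord.
by apply/funext => t; rewrite mxE.
Qed.

Lemma measurable_fun_rVZ d (T : measurableType d) n (f : T -> R)
    (g : T -> 'rV[R]_n) :
  measurable_fun setT f -> measurable_fun setT g ->
  measurable_fun setT (fun t => f t *: g t).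
Proof.
move=> mf mg; apply: measurable_fun_rVP => i.
rewrite (_ : (fun _ => _) = (fun t => (f t : R) * g t ord0 i)).
  by apply: measurable_funM => //; exact: measurable_fun_rV_coord.
by apply/funext => t; rewrite mxE.
Qed.

Lemma measurable_fun_rVB d (T : measurableType d) n (f g : T -> 'rV[R]_n) :
  measurable_fun setT f -> measurable_fun setT g ->
  measurable_fun setT (fun t => f t - g t).
Proof.
move=> mf mg; apply: measurable_fun_rVD => //.
under eq_fun do rewrite -scaleN1r.
exact: measurable_fun_rVZ.
Qed.

Lemma measurable_fun_dotp d (T : measurableType d) n (f g : T -> 'rV[R]_n) :
  measurable_fun setT f -> measurable_fun setT g ->
  measurable_fun setT (fun t => dotp (f t) (g t)).
Proof.
move=> mf mg; rewrite /dotp; apply: measurable_sum => i.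
by apply: measurable_funM; exact: measurable_fun_rV_coord.
Qed.

Lemma measurable_fun_enorm d (T : measurableType d) n (f : T -> 'rV[R]_n) :
  measurable_fun setT f -> measurable_fun setT (fun t => enorm (f t)).
Proof.
move=> mf; apply: (@measurableT_comp _ _ _ _ _ _ (@Num.sqrt R)).
  apply: continuous_measurable_fun; exact: sqrt_continuous.
exact: measurable_fun_dotp.
Qed.

Lemma measurable_rV_box n (A : 'I_n -> set R) :
  (forall i, measurable (A i)) ->
  measurable [set x : 'rV[R]_n | forall i, A i (x ord0 i)].
Proof.
move=> mA.
rewrite (_ : mkset _ = \bigcap_(i in [set: 'I_n])
    [set x : 'rV[R]_n | A i (x ord0 i)]); last first.
  by apply/seteqP; split => [x xA i _|x xA i]; exact: xA.
apply: fin_bigcap_measurable => [|i _]; first exact: finite_finset.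
rewrite -[X in measurable X]setTI.
by have := @measurable_rV_coord R n i measurableT _ (mA i).
Qed.

(** The library norm is the sup norm, so its balls are boxes, which the cylinder sigma-algebra
    contains. *)
Lemma ball_rVE n (a : 'rV[R]_n) (e : R) : 0 < e ->
  ball a e = [set x : 'rV[R]_n | forall i, ball (a ord0 i) e (x ord0 i)].
Proof.
move=> e0; rewrite -(@ball_normE _ 'rV[R]_n) -ball_normE.
apply/seteqP; split => x /=.
  move=> axe i; apply: le_lt_trans axe.
  rewrite [leRHS]mx_normrE (le_trans _ (le_bigmax _ _ (ord0, i)))//=.
  by rewrite !mxE.
move=> axe; rewrite [ltLHS]mx_normrE; apply/bigmax_ltP; split => //.
by move=> [j i] _ /=; rewrite ord1 !mxE; exact: axe.
Qed.

(** Countably many cubes with rational centre and radius [1 / (k + 1)] exhaust [U]. *)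
Lemma open_rV_measurable n (U : set 'rV[R]_n) : open U -> measurable U.
Proof.
move=> oU.
pose c (q : {ffun 'I_n -> rat}) : 'rV[R]_n := \row_i ratr (q i).
rewrite (_ : U = \bigcup_(q : {ffun 'I_n -> rat})
    (\bigcup_(k in [set k : nat | ball (c q) k.+1%:R^-1 `<=` U])
      (ball (c q) k.+1%:R^-1))).
  apply: countable_bigcupT_measurable => [|q]; first exact: countableP.
  apply: bigcup_measurable => k _; rewrite ball_rVE//.
  apply: (measurable_rV_box (A := fun i => ball (c q ord0 i) k.+1%:R^-1)) => i.
  exact: measurable_ball.
apply/seteqP; split => x; last by move=> [q _ [k kU /kU]].
move=> Ux; have /nbhs_ballP[/= e e0 xeU] := open_nbhs_nbhs (conj oU Ux).
(* With a radius below [e / 2], a cube that contains [x] stays within [e] of [x]. *)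
have [k ke] : exists k : nat, k.+1%:R^-1 < e / 2.
  exists (Num.truncn (e / 2)^-1); rewrite invf_plt ?posrE ?divr_gt0//.
  exact: truncnS_gt.
have /choice[q qP] (i : 'I_n) : exists q : rat,
    ball (x ord0 i) k.+1%:R^-1 (ratr q).
  have [q] := @rat_in_itvoo R (x ord0 i - k.+1%:R^-1) (x ord0 i + k.+1%:R^-1)
    (ltac:(rewrite ltrD2l gtrN ?invr_gt0//)).
  by rewrite inE => qx; exists q; rewrite ball_itv.
exists [ffun i => q i] => //.
have cx : ball (c [ffun i => q i]) k.+1%:R^-1 x.
  by rewrite ball_rVE// => i; rewrite mxE ffunE; apply: ball_sym.
exists k => //= y cy; apply: xeU.
by apply: (@ball_split _ _ (c [ffun i => q i])); apply: (le_ball (ltW ke)) => //;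
  exact: ball_sym.
Qed.

Lemma closed_rV_measurable n (C : set 'rV[R]_n) : closed C -> measurable C.
Proof.
move=> cC; rewrite -[C]setCK; apply: measurableC.
by apply: open_rV_measurable; exact: closed_openC.
Qed.

End rV_measurability.

(** * Tonelli, translations and dilations in dimension [n] *)

Section rV_lebesgue_integral.
Context {R : realType}.
Local Open Scope ereal_scope.
Local Notation lam n := (rV_lebesgue R n).
Local Notation mu := (@lebesgue_measure R).

Definition rV_tail n (u : 'rV[R]_n.+1) : 'rV[R]_n :=
  \row_j u ord0 (lift ord0 j).

Lemma rV_consD n (t : R) (z : 'rV[R]_n) (a : 'rV[R]_n.+1) :
  (rV_cons (t, z) + a = rV_cons (a ord0 ord0 + t, z + rV_tail a))%R.
Proof.
apply/rowP => i; rewrite [LHS]mxE.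
have [j ->|->] := unliftP ord0 i; last by rewrite !rV_cons0 addrC.
by rewrite !rV_consS !mxE.
Qed.

Lemma rV_consZ n (t r : R) (z : 'rV[R]_n) :
  (r *: rV_cons (t, z) = rV_cons (r * t, r *: z))%R.
Proof.
apply/rowP => i; rewrite mxE.
have [j ->|->] := unliftP ord0 i; last by rewrite !rV_cons0.
by rewrite !rV_consS mxE.
Qed.

Lemma dotp_rV_cons n (t : R) (z : 'rV[R]_n) (u : 'rV[R]_n.+1) :
  (dotp (rV_cons (t, z)) u = t * u ord0 ord0 + dotp z (rV_tail u))%R.
Proof.
rewrite /dotp big_ord_recl rV_cons0; congr +%R.
by apply: eq_bigr => i _; rewrite rV_consS mxE.
Qed.

Lemma measurable_rV_cons_tail n (F : 'rV[R]_n.+1 -> \bar R) (t : R) :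
  measurable_fun setT F -> measurable_fun setT (fun z => F (rV_cons (t, z))).
Proof.
move=> mF; apply: (measurableT_comp mF).
by apply: (measurableT_comp (@measurable_rV_cons R n)); exact: pair1_measurable.
Qed.

Lemma measurable_rV_cons_head n (F : 'rV[R]_n.+1 -> \bar R) (z : 'rV[R]_n) :
  measurable_fun setT F ->
  measurable_fun setT (fun t : R => F (rV_cons (t, z))).
Proof.
move=> mF; apply: (measurableT_comp mF).
by apply: (measurableT_comp (@measurable_rV_cons R n)); exact: pair2_measurable.
Qed.

Section tonelli.
Variables (n : nat) (F : 'rV[R]_n.+1 -> \bar R).
Hypothesis mF : measurable_fun setT F.
Hypothesis F0 : forall x, 0 <= F x.

Let mFc : measurable_fun setT (F \o @rV_cons R n).
Proof. exact: measurableT_comp mF (@measurable_rV_cons R n). Qed.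

Let integral_rV_cons :
  \int[lam n.+1]_x F x = \int[mu \x lam n]_p F (rV_cons p).
Proof.
rewrite -[LHS](_ : \int[pushforward (mu \x lam n) (@rV_cons R n)]_x F x = _)//.
rewrite ge0_integral_pushforward//.
exact: measurable_rV_cons.
Qed.

Lemma ge0_integral_rVS :
  \int[lam n.+1]_x F x = \int[mu]_t \int[lam n]_z F (rV_cons (t, z)).
Proof. rewrite integral_rV_cons (fubini_tonelli1 (F \o @rV_cons R n))// => x.
exact: F0. Qed.

(** Both orders are needed: the slab estimates integrate the head coordinate last or first,
    according to whether the direction is carried by the tail or by the head. *)
Lemma ge0_integral_rVS_swap :
  \int[lam n.+1]_x F x = \int[lam n]_z \int[mu]_t F (rV_cons (t, z)).
Proof. rewrite integral_rV_cons (fubini_tonelli2 (F \o @rV_cons R n))// => x.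
exact: F0. Qed.

Lemma measurable_integral_rV_tail :
  measurable_fun setT (fun t : R => \int[lam n]_z F (rV_cons (t, z))).
Proof. apply: (measurable_fun_fubini_tonelli_F (F \o @rV_cons R n)) => // x; exact: F0. Qed.

Lemma measurable_integral_rV_head :
  measurable_fun setT (fun z => \int[mu]_t F (rV_cons (t, z))).
Proof. apply: (measurable_fun_fubini_tonelli_G (F \o @rV_cons R n)) => // x; exact: F0. Qed.

End tonelli.

(** Induction on the dimension, as the measure is an iterated product: the tail translates by
    induction, the head by an affine substitution of slope [1]. *)
Lemma ge0_integral_rV_translate n (a : 'rV[R]_n) (F : 'rV[R]_n -> \bar R) :
  measurable_fun setT F -> (forall x, 0 <= F x) ->
  \int[lam n]_x F (x + a)%R = \int[lam n]_x F x.
Proof.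
elim: n a F => [a F mF F0|n ih a F mF F0].
  by apply: eq_integral => x _; congr F; apply/rowP => -[].
have mFa : measurable_fun setT (fun x : 'rV[R]_n.+1 => F (x + a)%R).
  by apply: (measurableT_comp mF); exact: measurable_fun_rVD.
rewrite (ge0_integral_rVS mF F0) (ge0_integral_rVS mFa)//.
under eq_integral do under eq_integral do rewrite rV_consD.
under eq_integral => t _.
  rewrite (ih _ (fun z => F (rV_cons (a ord0 ord0 + t, z))%R))//; last first.
    exact: measurable_rV_cons_tail.
  rewrite -[X in (_ + X)%R]mul1r.
  over.
rewrite (@ge0_integral_affine R _ _ (fun t => \int[lam n]_z F (rV_cons (t, z))))//.
- by rewrite normr1 invr1 mul1e.
- exact: measurable_integral_rV_tail.
- by move=> t; exact: integral_ge0.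
Qed.

Lemma ge0_integral_rV_scale n (r : R) (F : 'rV[R]_n -> \bar R) : (0 < r)%R ->
  measurable_fun setT F -> (forall x, 0 <= F x) ->
  \int[lam n]_x F (r *: x)%R = ((r^-1 ^+ n)%R)%:E * \int[lam n]_x F x.
Proof.
move=> r0; elim: n F => [F mF F0|n ih F mF F0].
  rewrite expr0 mul1e.
  by apply: eq_integral => x _; congr F; apply/rowP => -[].
have mFa : measurable_fun setT (fun x : 'rV[R]_n.+1 => F (r *: x)%R).
  by apply: (measurableT_comp mF); exact: measurable_fun_rVZ.
have ri : (0 <= r^-1 ^+ n)%R by rewrite exprn_ge0// invr_ge0 ltW.
rewrite (ge0_integral_rVS mF F0) (ge0_integral_rVS mFa)//.
under eq_integral do under eq_integral do rewrite rV_consZ.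
under eq_integral => t _.
  rewrite (ih (fun z => F (rV_cons (r * t, z))%R))//; last first.
    exact: measurable_rV_cons_tail.
  rewrite -[(r * t)%R]add0r.
  over.
rewrite (@ge0_integral_affine R _ _ (fun t => (r^-1 ^+ n)%:E *
  \int[lam n]_z F (rV_cons (t, z))))//.
- rewrite gtr0_norm// ge0_integralZl_EFin//; last 2 first.
  + by move=> t _; exact: integral_ge0.
  + exact: measurable_integral_rV_tail.
  by rewrite muleA -EFinM -exprS.
- by rewrite gt_eqF.
- by apply: measurable_funeM; exact: measurable_integral_rV_tail.
- by move=> t; apply: mule_ge0; rewrite ?lee_fin//; exact: integral_ge0.
Qed.

End rV_lebesgue_integral.

(** * The law of a linear form on a cube *)

Section slabs.
Context {R : realType}.
Local Open Scope ereal_scope.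
Local Notation lam n := (rV_lebesgue R n).
Local Notation mu := (@lebesgue_measure R).

Definition rV_box n (M : R) : set 'rV[R]_n :=
  [set x | forall i, (`|x ord0 i| <= M)%R].

Definition itv_sym (M : R) : set R := [set t | (`|t| <= M)%R].

Lemma itv_symE M : itv_sym M = `[(- M)%R, M]%classic.
Proof. by apply/seteqP; split => t; rewrite /itv_sym/= in_itv/= ler_norml. Qed.

Lemma measurable_itv_sym M : measurable (itv_sym M).
Proof. by rewrite itv_symE. Qed.

Lemma lebesgue_itv_sym M : (0 <= M)%R -> mu (itv_sym M) = (2 * M)%:E.
Proof.
move=> M0; rewrite itv_symE lebesgue_measure_itv/= lte_fin.
case: ltP => [_|]; first by rewrite -EFinB opprK -mulr2n mulr_natl.
move=> MM; have -> : M = 0%R by lra.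
by rewrite mulr0.
Qed.

Lemma measurable_rV_symbox n M : measurable (@rV_box n M).
Proof. exact: (measurable_rV_box (fun=> measurable_itv_sym M)). Qed.

Lemma lebesgue_rV_symbox n M : (0 <= M)%R -> lam n (rV_box M) = ((2 * M) ^+ n)%:E.
Proof.
move=> M0; rewrite /rV_box.
rewrite (@rV_lebesgue_box R n (fun=> itv_sym M)); last first.
  by move=> _; exact: measurable_itv_sym.
rewrite lebesgue_itv_sym// prodEFin; congr EFin.
by rewrite prodr_const card_ord.
Qed.

Lemma rV_box_cons n M (t : R) (z : 'rV[R]_n) :
  \1_(rV_box M) (rV_cons (t, z)) = (\1_(itv_sym M) t * \1_(rV_box M) z)%R :> R.
Proof.
rewrite !indicE -natrM mulnb; congr (nat_of_bool _)%:R.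
apply/idP/idP => [/[!inE] h|/andP[/[!inE] ht hz]].
  apply/andP; split; rewrite inE.
    by have := h ord0; rewrite rV_cons0.
  by move=> i; have := h (lift ord0 i); rewrite rV_consS.
by move=> i; have [j ->|->] := unliftP ord0 i; rewrite ?rV_cons0 ?rV_consS.
Qed.

Lemma ge0_integral_indicM d (T : measurableType d) (m : {measure set T -> \bar R})
    (A : set T) (k : \bar R) : measurable A -> 0 <= k ->
  \int[m]_x ((\1_A x)%:E * k) = m A * k.
Proof.
move=> mA k0; rewrite ge0_integralZr//; first by rewrite integral_indic// setIT.
exact/measurable_EFinP/measurable_indic.
Qed.

Lemma ge0_integral_itv_symM M (k : \bar R) : (0 <= M)%R -> 0 <= k ->
  \int[mu]_t ((\1_(itv_sym M) t)%:E * k) = (2 * M)%:E * k.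
Proof.
move=> M0 k0; rewrite ge0_integral_indicM//; last exact: measurable_itv_sym.
by congr (_ * _); exact: lebesgue_itv_sym.
Qed.

Lemma ge0_integral_rV_boxM n M (k : \bar R) : (0 <= M)%R -> 0 <= k ->
  \int[lam n]_z ((\1_(rV_box M) z)%:E * k) = ((2 * M) ^+ n)%:E * k.
Proof.
move=> M0 k0; rewrite ge0_integral_indicM//; last exact: measurable_rV_symbox.
by congr (_ * _); exact: lebesgue_rV_symbox.
Qed.

Section slab_fun.
Variables (n : nat) (M c : R) (u : 'rV[R]_n) (h : R -> \bar R).
Hypothesis mh : measurable_fun setT h.
Hypothesis h0 : forall t, 0 <= h t.

(** The offset [c] makes the family stable under fixing the first coordinate at [t], which only
    replaces [c] by [c + t * u ord0 ord0]. *)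
Definition slab_fun (x : 'rV[R]_n) := (\1_(rV_box M) x)%:E * h (c + dotp x u)%R.

Lemma slab_fun_ge0 x : 0 <= slab_fun x.
Proof. by rewrite mule_ge0// lee_fin. Qed.

Lemma measurable_slab_fun : measurable_fun setT slab_fun.
Proof.
apply: emeasurable_funM.
  by apply/measurable_EFinP/measurable_indic; exact: measurable_rV_symbox.
apply: (measurableT_comp mh); apply: measurable_funD => //.
exact: measurable_fun_dotp.
Qed.

End slab_fun.

Lemma slab_fun_cons n (M c : R) (u : 'rV[R]_n.+1) (h : R -> \bar R) t z :
  slab_fun M c u h (rV_cons (t, z)) =
  (\1_(itv_sym M) t)%:E * slab_fun M (c + t * u ord0 ord0) (rV_tail u) h z.
Proof. by rewrite /slab_fun rV_box_cons EFinM dotp_rV_cons muleA addrA. Qed.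

(** Integrating first along a coordinate with [dl <= |u j|] costs a factor [|u j|^-1 <= dl^-1], and
    the other coordinates contribute at most the volume of their cube. The constant is chosen before
    [u] and [c], which gives uniformity over the sphere. *)
Lemma slab_upper n (M dl : R) : (0 <= M)%R -> (0 < dl)%R ->
  exists2 C : R, (0 <= C)%R & forall (u : 'rV[R]_n) (c : R) (h : R -> \bar R),
    (exists j, (dl <= `|u ord0 j|)%R) -> measurable_fun setT h ->
    (forall t, 0 <= h t) ->
    \int[lam n]_x slab_fun M c u h x <= C%:E * \int[mu]_t h t.
Proof.
move=> M0 dl0; elim: n => [|n [C C0 ih]].
  by exists 0%R => // u c h [[]].
(* The first summand serves when the large coordinate is the head; the second when it lies in the
   tail, the head then adding its length [2 * M]. *)
exists ((2 * M) ^+ n / dl + 2 * M * C)%R.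
  by rewrite addr_ge0// ?divr_ge0 ?mulr_ge0// ?exprn_ge0 ?mulr_ge0// ltW.
move=> u c h [j uj] mh h0.
have mF := measurable_slab_fun M c u mh.
have F0 := slab_fun_ge0 M c u h0.
have ih0 : 0 <= \int[mu]_t h t by exact: integral_ge0.
rewrite EFinD ge0_muleDl ?lee_fin; last 2 first.
  by rewrite divr_ge0 ?exprn_ge0 ?mulr_ge0// ltW.
  by rewrite !mulr_ge0.
have [j' ej|ej] := unliftP ord0 j.
  rewrite ge0_integral_rVS//.
  apply: (@le_trans _ _ (\int[mu]_t ((\1_(itv_sym M) t)%:E * (C%:E * \int[mu]_t h t)))).
    apply: ge0_le_integral => //.
    - by move=> t _; exact: integral_ge0.
    - exact: measurable_integral_rV_tail.
    - apply: emeasurable_funM => //.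
      by apply/measurable_EFinP/measurable_indic; exact: measurable_itv_sym.
    - move=> t _; under eq_integral do rewrite slab_fun_cons.
      rewrite ge0_integralZl_EFin//; last 2 first.
      + by move=> z _; exact: slab_fun_ge0.
      + exact: measurable_slab_fun.
      apply: lee_wpmul2l; first by rewrite lee_fin.
      by apply: ih => //; exists j'; rewrite mxE -ej.
  rewrite ge0_integral_itv_symM ?mule_ge0 ?lee_fin//.
  rewrite muleA -EFinM leeDr// mule_ge0// lee_fin divr_ge0 ?exprn_ge0 ?mulr_ge0//.
  exact: ltW.
rewrite ge0_integral_rVS_swap//.
have u0 : (u ord0 ord0 != 0)%R.
  by rewrite -normr_gt0 (lt_le_trans dl0)// -ej.
apply: (@le_trans _ _ (\int[lam n]_z ((\1_(rV_box M) z)%:E *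
    ((`|u ord0 ord0|^-1)%:E * \int[mu]_t h t)))).
  apply: ge0_le_integral => //.
  - by move=> t _; exact: integral_ge0.
  - exact: measurable_integral_rV_head.
  - apply: emeasurable_funM => //.
    by apply/measurable_EFinP/measurable_indic; exact: measurable_rV_symbox.
  - move=> z _.
    have mhz : measurable_fun setT
        (fun t : R => h (c + dotp z (rV_tail u) + u ord0 ord0 * t)%R).
      by apply: (measurableT_comp mh); exact: measurable_affine.
    rewrite -(@ge0_integral_affine _ (c + dotp z (rV_tail u)))//.
    rewrite -ge0_integralZl_EFin//.
    apply: ge0_le_integral => //.
    + exact: measurable_rV_cons_head.
    + exact: measurable_funeM.
    + move=> t _; rewrite slab_fun_cons /slab_fun muleA -EFinM mulrC.
      rewrite [(_ + dotp z _)%R](_ : _ =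
        c + dotp z (rV_tail u) + u ord0 ord0 * t)%R; last by ring.
      rewrite EFinM -muleA lee_wpmul2l ?lee_fin//.
      by rewrite -[leRHS]mul1e lee_wpmul2r// lee_fin indicE; case: (_ \in _).
rewrite ge0_integral_rV_boxM ?mule_ge0 ?lee_fin//.
apply: (@le_trans _ _ (((2 * M) ^+ n / dl)%:E * \int[mu]_t h t)); last first.
  by rewrite leeDl// mule_ge0// lee_fin !mulr_ge0.
rewrite muleA -EFinM lee_wpmul2r// lee_fin ler_wpM2l ?exprn_ge0 ?mulr_ge0//.
by rewrite lef_pV2 ?posrE// ?normr_gt0// -ej.
Qed.

(** If the head coordinate of [u] is nonzero, the form sweeps an interval as the head varies,
    provided the tail is confined to a small cube; a zero head coordinate only multiplies the mass
    by [2 * r]. Here [eta] and [c0] may depend on [u]. *)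
Lemma slab_lower n (r : R) (u : 'rV[R]_n) : (0 < r)%R ->
  (exists j, u ord0 j != 0%R) ->
  exists2 eta : R, (0 < eta)%R & exists2 c0 : R, (0 < c0)%R &
    forall (c : R) (h : R -> \bar R), (`|c| <= eta)%R ->
    measurable_fun setT h -> (forall t, 0 <= h t) ->
    c0%:E * \int[mu]_t ((\1_(itv_sym eta) t)%:E * h t)
      <= \int[lam n]_x slab_fun r c u h x.
Proof.
move=> r0; elim: n u => [u [[]]//|n ih u uj].
have [u00|u0] := eqVneq (u ord0 ord0) 0%R.
  have [|eta eta0 [c0 c00 {}ih]] := ih (rV_tail u).
    move: uj => [j]; have [j' ->|->] := unliftP ord0 j; last by rewrite u00 eqxx.
    by move=> uj'; exists j'; rewrite mxE.
  exists eta => //; exists (2 * r * c0)%R; first by rewrite !mulr_gt0.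
  move=> c h ceta mh h0.
  have mF := measurable_slab_fun r c u mh.
  have F0 := slab_fun_ge0 r c u h0.
  set I := \int[mu]_t _.
  have I0 : 0 <= I.
    by apply: integral_ge0 => t _; rewrite mule_ge0// lee_fin.
  rewrite ge0_integral_rVS//.
  apply: (@le_trans _ _ (\int[mu]_t ((\1_(itv_sym r) t)%:E * (c0%:E * I)))).
    rewrite ge0_integral_itv_symM ?(ltW r0)// ?mule_ge0 ?lee_fin ?(ltW c00)//.
    by rewrite muleA -EFinM.
  apply: ge0_le_integral => //.
  - by move=> t _; rewrite mule_ge0 ?lee_fin// mule_ge0// lee_fin ltW.
  - apply: emeasurable_funM => //.
    by apply/measurable_EFinP/measurable_indic; exact: measurable_itv_sym.
  - exact: measurable_integral_rV_tail.
  - move=> t _; under eq_integral do rewrite slab_fun_cons u00 mulr0 addr0.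
    rewrite ge0_integralZl_EFin//; last 2 first.
    + by move=> z _; exact: slab_fun_ge0.
    + exact: measurable_slab_fun.
    by apply: lee_wpmul2l; [rewrite lee_fin|exact: ih].
have un0 : (0 < `|u ord0 ord0|)%R by rewrite normr_gt0.
set a := (`|u ord0 ord0|)%R in un0 *.
pose S := (\sum_j `|rV_tail u ord0 j|)%R.
have S0 : (0 <= S)%R by apply: sumr_ge0.
(* Chosen so that [s * S], a bound for the tail form, is at most [a * r / 4]; [1 + S] avoids a zero
   denominator, and the minimum with [r] stays in the original cube. *)
pose s := Num.min r (a * r / (4 * (1 + S)))%R.
have s0 : (0 < s)%R.
  by rewrite lt_min r0 divr_gt0 ?mulr_gt0// ltr_pwDl.
have sdot (z : 'rV[R]_n) : rV_box s z -> (`|dotp z (rV_tail u)| <= a * r / 4)%R.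
  move=> zs; rewrite /dotp (le_trans (ler_norm_sum _ _ _))//.
  apply: (@le_trans _ _ (s * S)%R).
    rewrite /S mulr_sumr ler_sum// => i _; rewrite normrM ler_wpM2r//.
  have -> : (a * r / 4 = a * r / (4 * (1 + S)) * (1 + S))%R.
    by field; rewrite gt_eqF// ltr_pwDl.
  by rewrite ler_pM ?(ltW s0)// ?ge_min ?lexx ?orbT// lerDr.
(* Offset, tail form and target value are each at most [a * r / 4] in modulus, so the head
   coordinate that reaches the target has modulus at most [3 / 4 * r] and lies in the cube. *)
exists (a * r / 4)%R; first by rewrite divr_gt0// mulr_gt0.
exists ((2 * s) ^+ n / a)%R; first by rewrite divr_gt0// exprn_gt0// mulr_gt0.
move=> c h ceta mh h0.
have mF := measurable_slab_fun r c u mh.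
have F0 := slab_fun_ge0 r c u h0.
pose h' t := (\1_(itv_sym (a * r / 4)) t)%:E * h t.
have h'0 t : 0 <= h' t by rewrite mule_ge0// lee_fin.
have mh' : measurable_fun setT h'.
  apply: emeasurable_funM => //.
  by apply/measurable_EFinP/measurable_indic; exact: measurable_itv_sym.
rewrite -/h' ge0_integral_rVS_swap//.
have I0 : 0 <= \int[mu]_t h' t by exact: integral_ge0.
apply: (@le_trans _ _ (\int[lam n]_z ((\1_(rV_box s) z)%:E *
    ((a^-1)%:E * \int[mu]_t h' t)))).
  rewrite ge0_integral_rV_boxM ?(ltW s0)// ?mule_ge0 ?lee_fin ?invr_ge0 ?(ltW un0)//.
  by rewrite muleA -EFinM.
apply: ge0_le_integral => //.
- by move=> z _; rewrite mule_ge0 ?lee_fin// mule_ge0// lee_fin invr_ge0 ltW.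
- apply: emeasurable_funM => //.
  by apply/measurable_EFinP/measurable_indic; exact: measurable_rV_symbox.
- exact: measurable_integral_rV_head.
- move=> z _; rewrite indicE; have [zs|] := boolP (z \in _); last first.
    by rewrite mul0e => _; exact: integral_ge0.
  rewrite inE in zs; rewrite mul1e.
  rewrite -(@ge0_integral_affine _ (c + dotp z (rV_tail u)))//.
  apply: ge0_le_integral => //.
  + apply: (measurableT_comp mh'); exact: measurable_affine.
  + exact: measurable_rV_cons_head.
  + move=> t _; rewrite slab_fun_cons /slab_fun.
    rewrite [X in h X](_ : _ = c + dotp z (rV_tail u) + u ord0 ord0 * t)%R; last by ring.
    rewrite muleA /h'; apply: lee_wpmul2r => //.
    rewrite -EFinM lee_fin [leLHS]indicE.
    have [/[!inE] hz|_] := boolP (_ \in itv_sym _); last by rewrite mulr_ge0.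
    have -> : \1_(rV_box r) z = 1%R :> R.
      rewrite indicE mem_set// => i; rewrite (le_trans (zs i))//.
      by rewrite ge_min lexx.
    rewrite mulr1 indicE mem_set// /itv_sym/=.
    rewrite -(ler_pM2l un0) -normrM.
    have := sdot _ zs; move: hz ceta; rewrite /itv_sym/= !ler_norml => /andP[? ?].
    by move=> /andP[? ?] /andP[? ?]; apply/andP; split; lra.
Qed.

End slabs.

(** * The Box-Cox functions *)

Section box_cox.
Context {R : realType}.
Implicit Types p q t x : R.

Definition box_cox q t : R := if q == 0 then t else (expR (q * t) - 1) / q.

Lemma box_cox0 q : box_cox q 0 = 0.
Proof. by rewrite /box_cox mulr0 expR0 subrr mul0r if_same. Qed.

Lemma expR_tangent (x y : R) : expR y * (1 + (x - y)) <= expR x.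
Proof.
have -> : expR x = expR y * expR (x - y) by rewrite -expRD; congr expR; ring.
by rewrite ler_wpM2l ?expR_ge0// expR_ge1Dx.
Qed.

(** The tangent inequality at [a * x], taken at [x] and at [0] with weights [a] and [1 - a]: the
    linear terms cancel. *)
Lemma expR_convex0 (a x : R) : 0 <= a <= 1 ->
  expR (a * x) <= a * expR x + (1 - a).
Proof.
move=> /andP[a0 a1].
have h1 := ler_wpM2l a0 (expR_tangent x (a * x)).
have a1' : 0 <= 1 - a by rewrite subr_ge0.
have := ler_wpM2l a1' (expR_tangent 0 (a * x)).
rewrite expR0; move: h1; set e := expR (a * x); set f := expR x.
move=> h1 h2; by have :
  e * (a * (1 + (x - a * x)) + (1 - a) * (1 + (0 - a * x))) <= a * f + (1 - a);
  [lra|rewrite (_ : _ + _ = 1) ?mulr1//; ring].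
Qed.

(** [box_cox q t] is the slope of the convex function [r |-> expR (r * t)] between [0] and [q], or
    its derivative at [0] when [q = 0]. Exponents of equal sign are compared by [expR_convex0], the
    others through the value [t] at [0]. *)
Lemma box_cox_le p q t : p <= q -> box_cox p t <= box_cox q t.
Proof.
have le_exp x : x <= expR x - 1 by have := expR_ge1Dx x; lra.
have low r : r < 0 -> box_cox r t <= t.
  move=> r0; rewrite /box_cox lt_eqF// ler_ndivrMr//.
  by rewrite mulrC; exact: le_exp.
have up r : 0 < r -> t <= box_cox r t.
  move=> r0; rewrite /box_cox gt_eqF// ler_pdivlMr//.
  by rewrite mulrC; exact: le_exp.
rewrite le_eqVlt => /predU1P[->//|pq].
have [p0|p0|p0] := ltgtP p 0.
- have [q0|q0|q0] := ltgtP q 0.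
  + have : expR (q / p * (p * t)) <= q / p * expR (p * t) + (1 - q / p).
      apply: expR_convex0; apply/andP; split.
        by rewrite ltW// -[_ / _]mulrNN -invrN divr_gt0// oppr_gt0.
      by rewrite ler_ndivrMr// mul1r ltW.
    have -> : q / p * (p * t) = q * t by field; rewrite lt_eqF.
    move=> h; rewrite /box_cox !lt_eqF// ler_ndivlMr//.
    have -> : (expR (p * t) - 1) / p * q = q / p * (expR (p * t) - 1) by ring.
    by lra.
  + exact: le_trans (low _ p0) (up _ q0).
  + by rewrite q0 {2}/box_cox eqxx; exact: low.
- have q0 := lt_trans p0 pq.
  have : expR (p / q * (q * t)) <= p / q * expR (q * t) + (1 - p / q).
    apply: expR_convex0; apply/andP; split; first by rewrite ltW// divr_gt0.
    by rewrite ler_pdivrMr// mul1r ltW.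
  have -> : p / q * (q * t) = p * t by field; rewrite gt_eqF.
  move=> h; rewrite /box_cox !gt_eqF// ler_pdivrMr//.
  have -> : (expR (q * t) - 1) / q * p = p / q * (expR (q * t) - 1) by ring.
  by lra.
- by rewrite p0 {1}/box_cox eqxx; apply: up; rewrite -p0.
Qed.

(** A quantitative inverse: it converts a bound on [box_cox q t] into one on [t], as the Lipschitz
    estimate of the log-moment requires. *)
Lemma box_cox_lower q t : 0 <= t -> t * expR (- (`|q| * t)) <= box_cox q t.
Proof.
move=> t0; rewrite /box_cox; have [->|q0] := eqVneq q 0.
  by rewrite normr0 mul0r oppr0 expR0 mulr1.
move: q0; rewrite neq_lt => /orP[q0|q0].
  rewrite ltr0_norm// mulNr opprK ler_ndivlMr//.
  by have := expR_tangent 0 (q * t); rewrite expR0; lra.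
rewrite gtr0_norm// ler_pdivlMr//.
have := expR_ge1Dx (q * t).
have : t * q * expR (- (q * t)) <= t * q.
  rewrite ler_piMr ?mulr_ge0 ?(ltW q0)// -[leRHS]expR0 ler_expR.
  by rewrite oppr_le0 mulr_ge0// ltW.
by lra.
Qed.

Lemma box_cox_le0 q t : box_cox q t <= 0 -> t <= 0.
Proof.
apply: contraTT; rewrite -!ltNge => t0.
by apply: lt_le_trans (box_cox_lower q (ltW t0)); rewrite mulr_gt0// expR_gt0.
Qed.

Lemma box_cox_ge0 q t : t <= 0 -> box_cox q t <= 0.
Proof.
move=> t0; rewrite /box_cox; case: eqVneq => // q0.
move: q0; rewrite neq_lt => /orP[q0|q0].
  by rewrite ler_ndivrMr// mul0r subr_ge0 -expR0 ler_expR nmulr_rge0.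
by rewrite ler_pdivrMr// mul0r subr_le0 -expR0 ler_expR pmulr_rle0.
Qed.

(** An envelope for all exponentials with exponent in [[a, b]], whatever the sign of [t]. *)
Definition expR2 (a b t : R) : R := expR (a * t) + expR (b * t).

Lemma expR_le_expR2 (a b c t : R) : a <= c <= b -> expR (c * t) <= expR2 a b t.
Proof.
move=> /andP[ac cb]; rewrite /expR2; have [t0|t0] := leP 0 t.
  by rewrite (@le_trans _ _ (expR (b * t)))// ?lerDr ?expR_ge0// ler_expR ler_wpM2r.
rewrite (@le_trans _ _ (expR (a * t)))// ?lerDl ?expR_ge0// ler_expR.
by rewrite ler_wnM2r// ltW.
Qed.

Lemma expR2M (a b c t : R) :
  expR2 a b t * expR (c * t) = expR2 (a + c) (b + c) t.
Proof. by rewrite /expR2 !mulrDl !expRD. Qed.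

(** Factors of [t] can thus be absorbed by moving exponents by [e], at the price of a factor
    [e^-1]. *)
Lemma norm_le_expR2 (e t : R) : 0 < e -> `|t| <= e^-1 * expR2 (- e) e t.
Proof.
move=> e0; rewrite mulrC ler_pdivlMr//.
have := expR_ge1Dx (`|t| * e).
have : expR (`|t| * e) <= expR2 (- e) e t.
  rewrite mulrC; have [t0|t0] := ger0P t.
    by apply: expR_le_expR2; rewrite lexx andbT; lra.
  by rewrite mulrN -mulNr; apply: expR_le_expR2; rewrite lexx/=; lra.
by lra.
Qed.

Lemma sqr_le_expR2 (e t : R) : 0 < e -> t ^+ 2 <= e^-2 * (2 * expR2 (- (2 * e)) (2 * e) t).
Proof.
move=> e0; rewrite -real_normK ?num_real//.
have h := norm_le_expR2 t e0.
have h0 := normr_ge0 t.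
apply: (@le_trans _ _ ((e^-1 * expR2 (- e) e t) ^+ 2)).
  by rewrite ler_pXn2r// nnegrE// mulr_ge0 ?invr_ge0 ?(ltW e0)// addr_ge0 ?expR_ge0.
rewrite exprMn exprVn ler_wpM2l ?invr_ge0 ?exprn_ge0 ?(ltW e0)//.
rewrite /expR2 mulNr (_ : - (2 * e) * t = - (e * t) + - (e * t)); last by ring.
rewrite (_ : (2 * e) * t = (e * t) + (e * t)); last by ring.
by rewrite !expRD; have := sqr_ge0 (expR (- (e * t)) - expR (e * t)); nra.
Qed.

Lemma norm_expRB (x y : R) : `|expR x - expR y| <= `|x - y| * (expR x + expR y).
Proof.
have half (a b : R) : expR a - expR b <= `|a - b| * (expR a + expR b).
  have := expR_tangent b a; have := expR_gt0 a; have := expR_gt0 b.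
  set ea := expR a; set eb := expR b => eb0 ea0 h.
  have : (a - b) * ea <= `|a - b| * ea by rewrite ler_pM2r// ler_norm.
  have : 0 <= `|a - b| * eb by rewrite mulr_ge0// ltW.
  by rewrite mulrDr; lra.
rewrite ler_norml; apply/andP; split; last exact: half.
by rewrite lerNl opprB distrC (addrC (expR x)); exact: half.
Qed.

(** Serves the exponent [0], where the difference of Box-Cox functions is this remainder divided by
    [q]. The term [1] covers negative [x]. *)
Lemma norm_expR_taylor1 x : `|expR x - 1 - x| <= x ^+ 2 * (expR x + 1).
Proof.
have := expR_ge1Dx x => h; rewrite ger0_norm; last by lra.
have := expR_gt0 x; have := expR_tangent 0 x; rewrite expR0.
set e := expR x in h * => h1 e0.
have h2 : e - 1 - x <= x * (e - 1) by lra.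
apply: (le_trans h2).
have [x0|x0] := leP 0 x.
  have : e - 1 <= x * e by lra.
  move=> /(ler_wpM2l x0).
  by have := sqr_ge0 x; rewrite expr2; lra.
have : (- x) * (1 - e) <= (- x) * (- x) by rewrite ler_pM2l ?oppr_gt0//; lra.
have : 0 <= x ^+ 2 * e by rewrite mulr_ge0 ?sqr_ge0 ?ltW.
by rewrite expr2; lra.
Qed.

Lemma norm_mul_expR (e a b c t : R) : 0 < e -> a + e <= c <= b - e ->
  `|t| * expR (c * t) <= e^-1 * (2 * expR2 a b t).
Proof.
move=> e0 /andP[ac cb].
apply: (le_trans (ler_wpM2r (expR_ge0 _) (norm_le_expR2 t e0))).
rewrite -mulrA ler_wpM2l ?invr_ge0 ?(ltW e0)// expR2M.
by rewrite mulr_natl mulr2n lerD// expR_le_expR2//; apply/andP; split; lra.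
Qed.

Lemma sqr_mul_expR (e a b c t : R) : 0 < e -> a + 2 * e <= c <= b - 2 * e ->
  t ^+ 2 * expR (c * t) <= e^-2 * (4 * expR2 a b t).
Proof.
move=> e0 /andP[ac cb].
apply: (le_trans (ler_wpM2r (expR_ge0 _) (sqr_le_expR2 t e0))).
rewrite -mulrA ler_wpM2l ?invr_ge0 ?exprn_ge0 ?(ltW e0)//.
rewrite -mulrA expR2M {1}/expR2.
have h1 : expR ((- (2 * e) + c) * t) <= expR2 a b t.
  by apply: expR_le_expR2; apply/andP; split; lra.
have h2 : expR ((2 * e + c) * t) <= expR2 a b t.
  by apply: expR_le_expR2; apply/andP; split; lra.
by lra.
Qed.

(** Varying [q] brings in factors [t] or [t ^+ 2], absorbed by an envelope with wider exponents. The
    lower exponent [a] has to stay above [-1] for the envelope to have a finite mean later, so the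
    window [dl] shrinks with [p + 1]. The case [p = 0] uses the Taylor remainder; for [p != 0] the
    window also keeps [q] away from [0]. *)
Lemma box_cox_lipschitz p : -1 < p ->
  exists a b C dl : R, [/\ -1 < a < 0, 0 <= b, 0 <= C, 0 < dl /\ a <= p - dl &
    forall q t, `|q - p| <= dl ->
      `|box_cox q t - box_cox p t| <= `|q - p| * (C * expR2 a b t)].
Proof.
(* [a] will lie at least [(p + 1) / 2] below [p]; the window takes at most [(p + 1) / 4] of that
   gap, which leaves [2 * e] for absorbing [t ^+ 2]. The bound [a <= - (1 / 2)] puts the exponent
   [0] inside [[a, b]]. *)
move=> p1; pose e := (p + 1) / 8; have e0 : 0 < e by rewrite /e; lra.
pose a := Num.min ((p - 1) / 2) (- (1 / 2)); pose b := 2 * `|p| + 2.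
have ap : a <= (p - 1) / 2 by rewrite /a ge_min lexx.
have a2 : a <= - (1 / 2) by rewrite /a ge_min lexx orbT.
have a1 : -1 < a by rewrite /a lt_min; apply/andP; split; lra.
have pn := ler_norm p; have pn0 := normr_ge0 p.
have bp : p + (p + 1) / 2 <= b by rewrite /b; lra.
have b2 : 2 <= b by rewrite /b; lra.
have eE : e = (p + 1) / 8 by [].
have E0 t : 0 <= expR2 a b t by rewrite addr_ge0 ?expR_ge0.
have [p0|p0] := eqVneq p 0.
  exists a, b, (e^-2 * 8), (1 / 4); split; try lra.
  - by rewrite mulr_ge0// invr_ge0 exprn_ge0// ltW.
  move=> q t; rewrite p0 subr0 => /ler_normlP[q1 q2].
  rewrite {2}/box_cox eqxx /box_cox.
  have [->|q0] := eqVneq q 0; first by rewrite subrr normr0 mul0r.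
  have -> : (expR (q * t) - 1) / q - t = (expR (q * t) - 1 - q * t) / q by field.
  rewrite normrM normfV ler_pdivrMr ?normr_gt0//.
  apply: (le_trans (norm_expR_taylor1 _)).
  have -> : `|q| * (e^-2 * 8 * expR2 a b t) * `|q| =
      q ^+ 2 * (e^-2 * 8 * expR2 a b t).
    by rewrite -(real_normK (num_real q)); ring.
  rewrite exprMn -[leLHS]mulrA ler_wpM2l ?sqr_ge0// mulrDr mulr1.
  have h1 : t ^+ 2 * expR (q * t) <= e^-2 * (4 * expR2 a b t).
    by apply: sqr_mul_expR => //; apply/andP; split; lra.
  have : t ^+ 2 * expR (0 * t) <= e^-2 * (4 * expR2 a b t).
    by apply: sqr_mul_expR => //; apply/andP; split; lra.
  by rewrite mul0r expR0; lra.
have pp : 0 < `|p| by rewrite normr_gt0.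
exists a, b, (8 / e / `|p| + 4 / `|p| / `|p|), (Num.min ((p + 1) / 4) (`|p| / 2)).
split; try lra.
- by rewrite addr_ge0// !mulr_ge0 ?invr_ge0// ltW.
- split; first by rewrite lt_min; apply/andP; split; lra.
  by have : Num.min ((p + 1) / 4) (`|p| / 2) <= (p + 1) / 4;
    [rewrite ge_min lexx|lra].
move=> q t; rewrite le_min => /andP[q1 q2].
have qp : `|p| / 2 <= `|q|.
  have := ler_normD (q - p) (- q).
  by rewrite normrN (_ : q - p - q = - p) ?normrN; [lra|ring].
have q0 : q != 0 by rewrite -normr_gt0; lra.
have qn0 : 0 < `|q| by rewrite normr_gt0.
rewrite /box_cox (negbTE q0) (negbTE p0).
(* Separates the change of the exponent from the change of the prefactor [1 / q]. *)
have -> : (expR (q * t) - 1) / q - (expR (p * t) - 1) / p =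
    (expR (q * t) - expR (p * t)) / q + (expR (p * t) - 1) * (p - q) / (p * q).
  by field; rewrite p0 q0.
move/ler_normlP : (q1) => [q3 q4].
have qi : `|q|^-1 <= 2 / `|p|.
  by rewrite (_ : 2 / `|p| = (`|p| / 2)^-1) ?lef_pV2 ?posrE ?divr_gt0// invfM invrK mulrC.
apply: (le_trans (ler_normD _ _)); rewrite [X in _ <= _ * X]mulrDl [leRHS]mulrDr lerD//.
  rewrite normrM normfV.
  apply: (@le_trans _ _ (`|q - p| * (e^-1 * (4 * expR2 a b t)) * (2 / `|p|))).
    apply: ler_pM => //.
    apply: (le_trans (norm_expRB _ _)).
    rewrite -mulrBl normrM -mulrA ler_wpM2l// mulrDr.
    have h1 : `|t| * expR (q * t) <= e^-1 * (2 * expR2 a b t).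
      by apply: norm_mul_expR => //; apply/andP; split; lra.
    have h2 : `|t| * expR (p * t) <= e^-1 * (2 * expR2 a b t).
      by apply: norm_mul_expR => //; apply/andP; split; lra.
    by lra.
  by rewrite le_eqVlt; apply/orP; left; apply/eqP; ring.
rewrite !normrM normfV normrM (distrC p).
apply: (@le_trans _ _ (2 * expR2 a b t * `|q - p| * (2 / `|p| / `|p|))).
  apply: ler_pM; [by rewrite mulr_ge0|by rewrite invr_ge0 mulr_ge0| |].
  - rewrite ler_wpM2r//; apply: (le_trans (ler_normB _ _)).
    rewrite normr1 ger0_norm ?expR_ge0//.
    have : expR (p * t) <= expR2 a b t.
      by apply: expR_le_expR2; apply/andP; split; lra.
    have : expR (0 * t) <= expR2 a b t.
      by apply: expR_le_expR2; apply/andP; split; lra.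
    by rewrite mul0r expR0; lra.
  - by rewrite invfM mulrC ler_wpM2r// invr_ge0 ltW.
by rewrite le_eqVlt; apply/orP; left; apply/eqP; ring.
Qed.

End box_cox.

(** * Log-moments of a weighted function *)

Section log_moment.
Context d (T : measurableType d) (R : realType).
Variable mu : {measure set T -> \bar R}.
Implicit Types (w Y f g : T -> R) (p q s b : R).

Definition wmean w f : R := \int[mu]_x (f x * w x).

Definition wintegrable w f := mu.-integrable setT (fun x => (f x * w x)%:E).

Definition log_moment w Y q : R :=
  if q == 0 then wmean w Y else ln (wmean w (fun x => expR (q * Y x))) / q.

(** A probability density [w] together with what makes all exponential moments of [Y] of exponent
    above [-1] finite. Where [w] vanishes only measurability is asked of [Y], and [b] is a parameter
    so that later constants can be uniform over a family. *)
Record tame w Y b : Prop := Tame {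
  tame_mw : measurable_fun setT w;
  tame_w0 : forall x, 0 <= w x;
  tame_w1 : (\int[mu]_x (w x)%:E)%E = 1%E;
  tame_mY : measurable_fun setT Y;
  tame_le : forall x, w x != 0 -> Y x <= b;
  tame_int : forall a, -1 < a < 0 ->
    (\int[mu]_x (expR (a * Y x) * w x)%:E < +oo)%E }.

Section tame.
Variables (w Y : T -> R) (b : R).
Hypothesis H : tame w Y b.
Let mw := tame_mw H.
Let w0 := tame_w0 H.
Let mY := tame_mY H.

Lemma wintegrable_le f g : measurable_fun setT f -> wintegrable w g ->
  (forall x, w x != 0 -> `|f x| <= g x) -> wintegrable w f.
Proof.
move=> mf ig fg; apply: le_integrable ig => //.
  by apply/measurable_EFinP; exact: measurable_funM.
move=> x _; rewrite /= lee_fin !normrM.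
have [->|wx] := eqVneq (w x) 0; first by rewrite normr0 !mulr0.
by rewrite ler_wpM2r// (le_trans (fg x wx))// ler_norm.
Qed.

Lemma wintegrableD f g : wintegrable w f -> wintegrable w g ->
  wintegrable w (fun x => f x + g x).
Proof.
move=> fi gi; rewrite /wintegrable; under eq_fun do rewrite mulrDl EFinD.
exact: integrableD.
Qed.

Lemma wintegrableZ k f : wintegrable w f -> wintegrable w (fun x => k * f x).
Proof.
move=> fi; rewrite /wintegrable; under eq_fun do rewrite -mulrA EFinM.
exact: integrableZl.
Qed.

Lemma wintegrable_cst k : wintegrable w (fun=> k).
Proof.
rewrite /wintegrable; under eq_fun do rewrite EFinM.
apply: integrableZl => //; apply/integrableP; split; first exact/measurable_EFinP.
under eq_integral => x _ do rewrite /= ger0_norm//.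
by rewrite (tame_w1 H) ltry.
Qed.

Lemma wmeanD f g : wintegrable w f -> wintegrable w g ->
  wmean w (fun x => f x + g x) = wmean w f + wmean w g.
Proof.
move=> fi gi; rewrite /wmean -RintegralD//.
by apply: eq_Rintegral => x _; rewrite mulrDl.
Qed.

Lemma wmeanZ k f : wintegrable w f ->
  wmean w (fun x => k * f x) = k * wmean w f.
Proof.
move=> fi; rewrite /wmean -RintegralZl//.
by apply: eq_Rintegral => x _; rewrite mulrA.
Qed.

Lemma wmean_cst k : wmean w (fun=> k) = k.
Proof.
have i1 := wintegrable_cst 1.
have -> : wmean w (fun=> k) = wmean w (fun=> k * 1) by rewrite mulr1.
rewrite wmeanZ// /wmean /Rintegral.
under eq_integral do rewrite mul1r.
by rewrite (tame_w1 H)/= mulr1.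
Qed.

Lemma wmean_le f g : wintegrable w f -> wintegrable w g ->
  (forall x, w x != 0 -> f x <= g x) -> wmean w f <= wmean w g.
Proof.
move=> fi gi fg; apply: le_Rintegral => // x _.
have [->|wx] := eqVneq (w x) 0; first by rewrite !mulr0.
by rewrite ler_wpM2r// fg.
Qed.

Lemma measurable_expRM q : measurable_fun setT (fun x => expR (q * Y x)).
Proof. by apply: measurableT_comp => //; exact: measurable_funM. Qed.

Lemma wintegrable_expR q : -1 < q -> wintegrable w (fun x => expR (q * Y x)).
Proof.
move=> q1; have [q0|q0] := leP 0 q.
  apply: (wintegrable_le _ (wintegrable_cst (expR (q * b)))).
    exact: measurable_expRM.
  move=> x wx; rewrite ger0_norm ?expR_ge0// ler_expR ler_wpM2l//.
  exact: tame_le H _ wx.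
apply/integrableP; split.
  apply/measurable_EFinP; apply: measurable_funM => //; exact: measurable_expRM.
under eq_integral => x _ do rewrite /= ger0_norm ?mulr_ge0 ?expR_ge0//.
by apply: (tame_int H); rewrite q1 q0.
Qed.

Lemma wintegrable_Y : wintegrable w Y.
Proof.
have e0 : (0 : R) < 1 / 2 by lra.
apply: (@wintegrable_le _ (fun x => (1 / 2)^-1 * expR2 (- (1 / 2)) (1 / 2) (Y x))) => //.
  by apply: wintegrableZ; apply: wintegrableD; apply: wintegrable_expR; lra.
by move=> x _; exact: norm_le_expR2.
Qed.

(** Jensen's inequality: the tangent to the exponential at [q] times the mean of [Y] integrates to a
    positive number. *)
Lemma wmean_expR_gt0 q : -1 < q -> 0 < wmean w (fun x => expR (q * Y x)).
Proof.
move=> q1; pose t := q * wmean w Y.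
apply: (@lt_le_trans _ _ (expR t)); first exact: expR_gt0.
have iY := wintegrable_Y.
have i1 := wintegrable_cst (expR t * (1 - t)).
have i2 := wintegrableZ (expR t * q) iY.
have -> : expR t = wmean w (fun x => expR t * q * Y x + expR t * (1 - t)).
  by rewrite wmeanD// wmean_cst wmeanZ// -mulrA -/t; ring.
apply: wmean_le.
- exact: wintegrableD.
- exact: wintegrable_expR.
move=> x _; have := expR_tangent (q * Y x) t; apply: le_trans.
by rewrite le_eqVlt; apply/orP; left; apply/eqP; ring.
Qed.

Lemma box_coxBE q s (t : R) : q != 0 ->
  box_cox q (t - s) = expR (- (q * s)) / q * expR (q * t) + (- q^-1).
Proof.
move=> q0; rewrite /box_cox (negbTE q0) (_ : q * (t - s) = - (q * s) + q * t); last by ring.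
by rewrite expRD; field.
Qed.

Lemma wintegrable_box_cox q s : -1 < q ->
  wintegrable w (fun x => box_cox q (Y x - s)).
Proof.
move=> q1; have [->|q0] := eqVneq q 0.
  rewrite /box_cox eqxx; apply: wintegrableD; first exact: wintegrable_Y.
  exact: wintegrable_cst.
rewrite /wintegrable; under eq_fun do rewrite box_coxBE//.
apply: wintegrableD; last exact: wintegrable_cst.
by apply: wintegrableZ; exact: wintegrable_expR.
Qed.

(** By [box_coxBE] both sides are the same affine function of the mean of [expR (q * Y)]; for
    [q = 0] this is linearity of the mean. *)
Lemma wmean_box_cox q s : -1 < q ->
  wmean w (fun x => box_cox q (Y x - s)) = box_cox q (log_moment w Y q - s).
Proof.
move=> q1; rewrite /log_moment; have [->|q0] := eqVneq q 0.
  rewrite /box_cox eqxx wmeanD ?wmean_cst//; first exact: wintegrable_Y.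
  exact: wintegrable_cst.
have ie := wintegrable_expR q1.
rewrite box_coxBE// [q * (_ / q)]mulrC divfK// lnK ?posrE ?wmean_expR_gt0//.
rewrite -wmeanZ// -[X in _ + X]wmean_cst -wmeanD//.
- by apply: eq_Rintegral => x _; rewrite box_coxBE.
- exact: wintegrableZ.
- exact: wintegrable_cst.
Qed.

Lemma log_moment_le_of q s : -1 < q ->
  wmean w (fun x => box_cox q (Y x - s)) <= 0 -> log_moment w Y q <= s.
Proof. by move=> q1; rewrite wmean_box_cox// => /box_cox_le0; rewrite subr_le0. Qed.

Lemma log_moment_mono p q : -1 < p -> p <= q ->
  log_moment w Y p <= log_moment w Y q.
Proof.
move=> p1 pq; have q1 := lt_le_trans p1 pq.
apply: log_moment_le_of => //.
have := wmean_box_cox (log_moment w Y q) q1; rewrite subrr box_cox0 => <-.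
apply: wmean_le; [exact: wintegrable_box_cox..|] => x _.
exact: box_cox_le.
Qed.

Lemma log_moment_ub q : -1 < q -> log_moment w Y q <= b.
Proof.
move=> q1; apply: log_moment_le_of => //; rewrite -[leRHS](wmean_cst 0).
apply: wmean_le; [exact: wintegrable_box_cox|exact: wintegrable_cst|].
by move=> x wx; apply: box_cox_ge0; rewrite subr_le0; exact: tame_le H _ wx.
Qed.

(** Monotonicity reduces to the exponent [a], and dividing by [a < 0] turns an upper bound on the
    moment into a lower bound. *)
Lemma log_moment_lb a A q : -1 < a < 0 -> a <= q ->
  wmean w (fun x => expR (a * Y x)) <= A -> ln A / a <= log_moment w Y q.
Proof.
move=> /andP[a1 a0] aq hA; apply: le_trans (log_moment_mono a1 aq).
have M0 := wmean_expR_gt0 a1.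
rewrite /log_moment lt_eqF// ler_nM2r ?invr_lt0//.
by rewrite ler_ln ?posrE// (lt_le_trans M0).
Qed.

(** Markov's inequality on [B]. The correction [ln m / q] vanishes as [q] grows, which makes [c] an
    asymptotic lower bound. *)
Lemma log_moment_lower_tail q (c m : R) (B : set T) : 0 < q -> measurable B ->
  (forall x, w x != 0 -> B x -> c <= Y x) -> 0 < m -> m <= wmean w \1_B ->
  c + ln m / q <= log_moment w Y q.
Proof.
move=> q0 mB Bc m0 mB0; have q1 : -1 < q by lra.
have iB : wintegrable w \1_B.
  apply: (wintegrable_le _ (wintegrable_cst 1)) => // x _.
  by rewrite ger0_norm// indicE; case: (_ \in _).
have : wmean w (fun x => expR (q * c) * \1_B x) <= wmean w (fun x => expR (q * Y x)).
  apply: wmean_le; [exact: wintegrableZ|exact: wintegrable_expR|] => x wx.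
  rewrite indicE; have [/[!inE] Bx|_] := boolP (_ \in _).
    by rewrite mulr1 ler_expR ler_wpM2l ?(ltW q0)//; exact: Bc.
  by rewrite mulr0 expR_ge0.
rewrite wmeanZ// => h.
have h' : expR (q * c) * m <= wmean w (fun x => expR (q * Y x)).
  by apply: le_trans h; rewrite ler_wpM2l ?expR_ge0.
rewrite /log_moment gt_eqF// ler_pdivlMr// mulrDl divfK ?gt_eqF// mulrC.
rewrite -[q * c]expRK -lnM ?posrE ?expR_gt0// ler_ln ?posrE ?mulr_gt0 ?expR_gt0//.
exact: wmean_expR_gt0.
Qed.

End tame.

End log_moment.

(** * Uniform Lipschitz dependence on the exponent *)

Section log_moment_lipschitz.
Variable (R : realType).
Implicit Types p q : R.

(* The constants depend on the moment [A] only, which makes the estimate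
   uniform over a family of pairs [(w, Y)]. *)
Lemma log_moment_lipschitz p : -1 < p ->
  exists2 a : R, -1 < a < 0 & forall A b : R,
  exists C dl : R, 0 < dl /\
    forall d (T : measurableType d) (mu : {measure set T -> \bar R})
      (w Y : T -> R), tame mu w Y b ->
      wmean mu w (fun x => expR (a * Y x)) <= A ->
    forall q, `|q - p| <= dl ->
      -1 < q /\ `|log_moment mu w Y q - log_moment mu w Y p| <= C * `|q - p|.
Proof.
move=> p1; have [a [c [C [dl [a1 c0 C0 [dl0 ap] HC]]]]] := box_cox_lipschitz p1.
exists a => // A b.
(* Bounds every log-moment of exponent at least [a]: from above through [b], from below through
   [ln A / a]. *)
pose B : R := `|b| + `|ln A / a|.
(* Bounds the mean of the envelope at [Y - l] for [|l| <= B]: the moment bound [A] controls the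
   exponent [a], the bound [Y <= b] the exponent [c]. *)
pose K : R := expR (`|a| * B) * A + expR (c * B) * expR (c * B).
(* The exponential undoes the loss in [box_cox_lower], where the exponent has modulus at most
   [|p| + dl] and the gap is at most [2 * B]. *)
exists (C * K * expR ((`|p| + dl) * (2 * B))), dl; split => // d T mu w Y H hA q qp.
have B0 : 0 <= B by rewrite addr_ge0.
have /andP[a11 a10] := a1.
have qa : a <= q by move/ler_normlP : qp => [q1 q2]; lra.
have q1 : -1 < q by lra.
split => //.
have bnd r : a <= r -> `|log_moment mu w Y r| <= B.
  move=> ar; have r1 : -1 < r by lra.
  have h1 := log_moment_ub H r1; have h2 := log_moment_lb H a1 ar hA.
  have := ler_norm b; have := ler_norm (- (ln A / a)); rewrite normrN.
  have := normr_ge0 b; have := normr_ge0 (ln A / a).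
  by rewrite /B => *; apply/ler_normlP; split; lra.
have A0 : 0 <= A by apply: le_trans hA; exact/ltW/(wmean_expR_gt0 H).
(* One-sided form: [s <= r] will be [p] and [q] in increasing order, and monotonicity makes the
   difference nonnegative. *)
have main r s : a <= r -> a <= s -> `|r| <= `|p| + dl ->
    (forall t, `|box_cox r t - box_cox s t| <= `|q - p| * (C * expR2 a c t)) ->
    s <= r ->
    log_moment mu w Y r - log_moment mu w Y s <=
      C * K * expR ((`|p| + dl) * (2 * B)) * `|q - p|.
  move=> ar as_ rp hrs sr.
  have r1 : -1 < r by lra.
  have s1 : -1 < s by lra.
  set l := log_moment mu w Y s.
  have D0 : 0 <= log_moment mu w Y r - l by rewrite subr_ge0 (log_moment_mono H).
  have D2 : log_moment mu w Y r - l <= 2 * B.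
    have /ler_normlP[x1 x2] := bnd _ ar; have /ler_normlP[x3 x4] := bnd _ as_.
    by rewrite -/l in x3 x4; lra.
  have /ler_normlP[x3 x4] := bnd _ as_; rewrite -/l in x3 x4.
  have e2B t : expR2 a c (t - l) =
      expR (- (a * l)) * expR (a * t) + expR (- (c * l)) * expR (c * t).
    by rewrite /expR2 -!expRD; congr (expR _ + expR _); ring.
  have ie : wintegrable mu w (fun x => expR2 a c (Y x - l)).
    under eq_fun do rewrite e2B.
    apply: wintegrableD.
      by apply: wintegrableZ; apply: (wintegrable_expR H); lra.
    by apply: wintegrableZ; apply: (wintegrable_expR H); lra.
  have EK : wmean mu w (fun x => expR2 a c (Y x - l)) <= K.
    under eq_fun do rewrite e2B.
    have ia : wintegrable mu w (fun x => expR (a * Y x)).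
      by apply: (wintegrable_expR H); lra.
    have ic : wintegrable mu w (fun x => expR (c * Y x)).
      by apply: (wintegrable_expR H); lra.
    rewrite wmeanD; [|exact: wintegrableZ..].
    rewrite !wmeanZ// /K lerD//.
      apply: ler_pM => //; rewrite ?expR_ge0//.
        by apply/ltW/(wmean_expR_gt0 H); lra.
      rewrite ler_expR -mulrN ltr0_norm// mulNr -mulrN.
      by rewrite ler_wnM2l ?(ltW a10)//; lra.
    apply: ler_pM => //; rewrite ?expR_ge0//.
    - by apply/ltW/(wmean_expR_gt0 H); lra.
    - by rewrite ler_expR -mulrN ler_wpM2l//; lra.
    rewrite -[leRHS](wmean_cst H); apply: (wmean_le H) => //.
      exact: (wintegrable_cst H).
    move=> x wx; rewrite ler_expR ler_wpM2l//.
    apply: (le_trans (tame_le H wx)); rewrite /B.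
    by have := ler_norm b; have := normr_ge0 (ln A / a); lra.
  have K0 : 0 <= K by rewrite /K addr_ge0 ?mulr_ge0 ?expR_ge0.
  (* Centring at [l] makes the mean of [box_cox s (Y - l)] vanish, so only the envelope term
     survives. *)
  have : box_cox r (log_moment mu w Y r - l) <= `|q - p| * (C * K).
    rewrite -(wmean_box_cox H)//.
    apply: (@le_trans _ _ (wmean mu w (fun x => box_cox s (Y x - l) +
        `|q - p| * C * expR2 a c (Y x - l)))).
      apply: (wmean_le H) => //.
      - exact: (wintegrable_box_cox H).
      - apply: wintegrableD; first exact: (wintegrable_box_cox H).
        exact: wintegrableZ.
      move=> x _; have := hrs (Y x - l); rewrite mulrA.
      by move/ler_normlP => [_]; lra.
    rewrite wmeanD; [|exact: (wintegrable_box_cox H)|exact: wintegrableZ].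
    rewrite (wmean_box_cox H)// subrr box_cox0 add0r wmeanZ//.
    by rewrite -mulrA ler_wpM2l// ler_wpM2l.
  move=> /(le_trans (box_cox_lower r D0)) h.
  set D := log_moment mu w Y r - l in D0 D2 h *.
  have e1 : expR (- ((`|p| + dl) * (2 * B))) <= expR (- (`|r| * D)).
    by rewrite ler_expR lerN2; apply: ler_pM.
  have := le_trans (ler_wpM2l D0 e1) h.
  rewrite expRN ler_pdivrMr ?expR_gt0// => /le_trans; apply.
  by rewrite le_eqVlt; apply/orP; left; apply/eqP; ring.
have qn : `|q| <= `|p| + dl.
  by have := ler_normD (q - p) p; rewrite subrK; lra.
have pa : a <= p by lra.
have pn : `|p| <= `|p| + dl by lra.
have [qlep|pltq] := leP q p.
  rewrite distrC ger0_norm; last by rewrite subr_ge0 (log_moment_mono H).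
  by apply: main => // t; rewrite distrC; exact: HC.
rewrite ger0_norm; last by rewrite subr_ge0 (log_moment_mono H)// ltW.
apply: main => // [t|]; [exact: HC|exact: ltW].
Qed.

End log_moment_lipschitz.

Lemma measurable_fun_indic_comp d d' (T : measurableType d)
    (U : measurableType d') (R : realType) (A : set U) (f : T -> U) :
  measurable A -> measurable_fun setT f ->
  measurable_fun setT (fun t => \1_A (f t) : R).
Proof. by move=> mA mf; apply: measurableT_comp mf. Qed.

(** * The covariogram of a convex body *)

Section covariogram.
Context {R : realType} {n : nat}.
Local Notation lam := (rV_lebesgue R n).
Variable K : set 'rV[R]_n.
Hypothesis cbK : convex_body K.

Let cK : compact K. Proof. by case: cbK. Qed.

Lemma convex_body_measurable : measurable K.
Proof.
by apply: closed_rV_measurable; exact: compact_closed.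
Qed.
Let mK := convex_body_measurable.

Lemma convex_bodyP x y (k : R) : 0 <= k <= 1 -> K x -> K y ->
  K (k *: x + (1 - k) *: y).
Proof.
move=> /andP[k0 k1] Kx Ky; have [_ cvK _] := cbK.
have := cvK x y (Itv01 k0 k1); rewrite !inE; exact.
Qed.

Lemma rV_norm_coord (x : 'rV[R]_n) i : `|x ord0 i| <= `|x|.
Proof. by rewrite [leRHS]mx_normrE (le_trans _ (le_bigmax _ _ (ord0, i))). Qed.

Lemma convex_body_bounded : exists2 D : R, 0 < D & K `<=` rV_box D.
Proof.
have [M [_ HM]] := compact_bounded cK.
exists (`|M| + 1) => [|x Kx i]; first by rewrite ltr_wpDl.
apply: (le_trans (rV_norm_coord _ _)); apply: HM => //.
by rewrite (le_lt_trans (ler_norm _))// ltrDl.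
Qed.

Lemma convex_body_interior : exists ctr, exists2 r : R, 0 < r &
  forall x, rV_box r x -> K (ctr + x).
Proof.
have [_ _ [ctr +] ] := cbK; rewrite /interior/= => /nbhs_ballP[/= e e0 eK].
exists ctr, (e / 2); first by rewrite divr_gt0.
move=> x xe; apply: eK; rewrite ball_rVE// => i.
rewrite -ball_normE/= mxE opprD addrA subrr add0r normrN.
by rewrite (le_lt_trans (xe i))// ltr_pdivrMr// ltr_pMr// ltr1n.
Qed.

Lemma lebesgue_convex_body_fin : (lam K < +oo)%E.
Proof.
have [D D0 KD] := convex_body_bounded.
have := @lebesgue_rV_symbox R n D (ltW D0).
move=> E; apply: (@le_lt_trans _ _ (lam (rV_box D))); last by rewrite E ltry.
by apply: le_measure => //; rewrite inE//; exact: measurable_rV_symbox.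
Qed.

Lemma vol_convex_body : (vol K)%:E = lam K.
Proof. by rewrite /vol fineK// ge0_fin_numE//; exact: lebesgue_convex_body_fin. Qed.

Lemma translateE z : translate K z = [set y | K (y - z)].
Proof.
apply/seteqP; split => [_ [y Ky <-]|y Ky] /=; first by rewrite addrK.
by exists (y - z) => //; rewrite subrK.
Qed.

(** Kept as a function of two variables: its joint measurability yields that of the covariogram by
    Tonelli. *)
Definition covariogram_fun z y : R := \1_K y * \1_K (y - z).

Lemma indic_covariogram z : \1_(K `&` translate K z) = covariogram_fun z.
Proof.
by apply/funext => y; rewrite translateE indicI/= /covariogram_fun !indicE.
Qed.

Lemma measurable_covariogram_fun :
  measurable_fun setT (fun p : 'rV[R]_n * 'rV[R]_n => covariogram_fun p.1 p.2).
Proof.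
apply: measurable_funM; apply: measurable_fun_indic_comp => //.
exact: measurable_fun_rVB.
Qed.

Lemma measurable_covariogram_set z : measurable (K `&` translate K z).
Proof.
apply: measurableI => //; rewrite translateE -[X in measurable X]setTI.
exact: (@measurable_fun_rVB _ _ _ _ id (cst z)).
Qed.

Lemma covariogramE z :
  (covariogram K z)%:E = (\int[lam]_y (covariogram_fun z y)%:E)%E.
Proof.
have mKz := measurable_covariogram_set z.
rewrite /covariogram /vol fineK; last first.
  rewrite ge0_fin_numE//; apply: le_lt_trans lebesgue_convex_body_fin.
  by apply: le_measure; rewrite ?inE//; exact: subIset.
by rewrite -indic_covariogram integral_indic// setIT.
Qed.

Lemma covariogram_fun_ge0 z y : 0 <= covariogram_fun z y.
Proof. by rewrite mulr_ge0. Qed.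

Lemma measurable_covariogram : measurable_fun setT (covariogram K).
Proof.
apply/measurable_EFinP.
rewrite (_ : EFin \o _ = fun z => \int[lam]_y (covariogram_fun z y)%:E)%E; last first.
  by apply/funext => z /=; rewrite covariogramE.
apply: (measurable_fun_fubini_tonelli_F
  (fun p : 'rV[R]_n * 'rV[R]_n => (covariogram_fun p.1 p.2)%:E)) => [|p].
  by apply/measurable_EFinP; exact: measurable_covariogram_fun.
by rewrite lee_fin covariogram_fun_ge0.
Qed.

Lemma covariogram_ge0 z : 0 <= covariogram K z.
Proof. by rewrite /covariogram /vol fine_ge0. Qed.

Lemma covariogram_le_vol z : covariogram K z <= vol K.
Proof.
rewrite -lee_fin vol_convex_body /covariogram /vol.
have mKz := measurable_covariogram_set z.
rewrite fineK; first by apply: le_measure; rewrite ?inE//; exact: subIset.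
rewrite ge0_fin_numE//; apply: le_lt_trans lebesgue_convex_body_fin.
by apply: le_measure; rewrite ?inE//; exact: subIset.
Qed.

Lemma diff_bodyP z : diff_body K z <-> exists a b, [/\ K a, K b & z = a - b].
Proof.
rewrite /diff_body/= translateE; split => [[y [Ky Kyz]]|[a [b [Ka Kb ->]]]].
  by exists y, (y - z); split => //; rewrite opprB addrC subrK.
by exists a; split => //=; rewrite opprB addrC subrK.
Qed.

Lemma covariogram_supp z : covariogram K z != 0 -> diff_body K z.
Proof.
apply: contraNP => /set0P/negP/negPn/eqP h.
by rewrite /covariogram h /vol measure0.
Qed.

Lemma diff_body_bounded : exists2 D : R, 0 < D & diff_body K `<=` rV_box D.
Proof.
have [D D0 KD] := convex_body_bounded.
exists (2 * D); first by rewrite mulr_gt0.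
move=> z /diff_bodyP[a [b [/KD Ka /KD Kb ->]]] i; rewrite !mxE.
apply: (le_trans (ler_normB _ _)).
by have := Ka i; have := Kb i; lra.
Qed.

(** By convexity [K] contains cubes of half-width [2 * e] about [l *: ctr + (1 - l) *: a] and about
    the same combination with [b]; the centres differ by [(1 - l) *: (a - b)]. Hence [K] and its
    translate by [z] share a cube as long as [z] is close to that difference. *)
Lemma covariogram_lower a b (l : R) : K a -> K b -> 0 < l <= 1 ->
  exists2 e : R, 0 < e & exists2 c : R, 0 < c &
    forall z, rV_box e (z - (1 - l) *: (a - b)) -> c <= covariogram K z.
Proof.
move=> Ka Kb /andP[l0 l1].
have [ctr [r r0 orK]] := convex_body_interior.
(* Of the half-width [l * r] available, one half is for the point of the shared cube, the other for
   the deviation of [z]. *)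
pose e := l * (r / 2); have e0 : 0 < e by rewrite !mulr_gt0.
exists e => //; exists ((2 * e) ^+ n); first by rewrite exprn_gt0// mulr_gt0.
have l01 : 0 <= l <= 1 by rewrite l1 ltW.
have inK (x y : 'rV[R]_n) : K x -> rV_box (2 * e) y ->
    K (l *: ctr + (1 - l) *: x + y).
  move=> Kx ye.
  have -> : l *: ctr + (1 - l) *: x + y = l *: (ctr + l^-1 *: y) + (1 - l) *: x.
    by rewrite scalerDr scalerA mulfV ?gt_eqF// scale1r addrAC.
  apply: convex_bodyP => //; apply: orK => i; rewrite mxE normrM.
  rewrite gtr0_norm ?invr_gt0// mulrC ler_pdivrMr//.
  by apply: (le_trans (ye i)); rewrite /e; lra.
move=> z ze; set v := z - _ in ze.
have zv : z = v + (1 - l) *: (a - b) by rewrite /v subrK.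
pose p := l *: ctr + (1 - l) *: a.
have mKz := measurable_covariogram_set z.
have sub x : rV_box e (x - p) -> (K `&` translate K z) x.
  move=> xe; rewrite translateE; split => /=.
    rewrite (_ : x = p + (x - p)); last by rewrite addrC subrK.
    by apply: inK => // i; apply: (le_trans (xe i)); lra.
  rewrite (_ : x - z = l *: ctr + (1 - l) *: b + ((x - p) - v)); last first.
    rewrite zv /p scalerBr; move: (l *: ctr) ((1 - l) *: a) ((1 - l) *: b) => A B C.
    by apply/rowP => i; rewrite !mxE; ring.
  apply: inK => // i; rewrite !mxE.
  apply: (le_trans (ler_normB _ _)).
  by have := xe i; have := ze i; rewrite !mxE; lra.
rewrite -lee_fin covariogramE -(lebesgue_rV_symbox n (ltW e0)).
have mb : measurable (@rV_box R n e) by exact: measurable_rV_symbox.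
have -> : lam (rV_box e) = (\int[lam]_x (\1_(rV_box e) (x - p))%:E)%E.
  rewrite (@ge0_integral_rV_translate R n (- p) (fun x => (\1_(rV_box e) x)%:E))//.
    by rewrite integral_indic// setIT.
  by apply/measurable_EFinP; exact: measurable_indic.
apply: ge0_le_integral => //.
- apply/measurable_EFinP.
  have mp : measurable_fun setT (fun y : 'rV[R]_n => y - p).
    exact: measurable_fun_rVB.
  exact: (measurable_fun_indic_comp mb mp).
- apply/measurable_EFinP.
  exact: (measurableT_comp measurable_covariogram_fun (pair1_measurable z)).
move=> x _; rewrite lee_fin -indic_covariogram [leLHS]indicE.
have [/[!inE] /sub xK|_] := boolP (_ \in rV_box e); last by [].
by rewrite indicE mem_set.
Qed.

Lemma covariogram_near0 : exists2 e : R, 0 < e & exists2 c : R, 0 < c &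
  forall z, rV_box e z -> c <= covariogram K z.
Proof.
have [_ _ [ctr /interior_subset Ko]] := cbK.
have [|e e0 [c c0 h]] := @covariogram_lower ctr ctr 1 Ko Ko; first by rewrite ltr01 lexx.
exists e => //; exists c => // z ze; apply: h.
by rewrite subrr scale0r subr0.
Qed.

Lemma vol_convex_body_gt0 : 0 < vol K.
Proof.
have [e e0 [c c0 h]] := covariogram_near0.
apply: (lt_le_trans c0); apply: le_trans (covariogram_le_vol 0); apply: h => i.
by rewrite mxE normr0 ltW.
Qed.

Lemma integral_covariogram :
  (\int[lam]_z (covariogram K z)%:E = (vol K ^+ 2)%:E)%E.
Proof.
under eq_integral do rewrite covariogramE.
(* This is [covariogram_fun] after translating [y] by [z]; in the swapped order the inner integral
   over [z] is again the volume of [K]. *)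
pose F (z y : 'rV[R]_n) : \bar R := (\1_K (y + z) * \1_K y)%:E.
have mF : measurable_fun setT (fun p : 'rV[R]_n * 'rV[R]_n => F p.1 p.2).
  apply/measurable_EFinP; apply: measurable_funM; apply: measurable_fun_indic_comp => //.
  exact: measurable_fun_rVD.
have F0 z y : (0 <= F z y)%E by rewrite lee_fin mulr_ge0.
transitivity (\int[lam]_z \int[lam]_y F z y)%E.
  apply: eq_integral => z _.
  rewrite -(ge0_integral_rV_translate z).
  - by apply: eq_integral => y _; rewrite /covariogram_fun addrK.
  - apply/measurable_EFinP.
    exact: (measurableT_comp measurable_covariogram_fun (pair1_measurable z)).
  - by move=> y; rewrite lee_fin covariogram_fun_ge0.
have EK : (\int[lam]_z (\1_K z)%:E = (vol K)%:E)%E.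
  by rewrite integral_indic// setIT; exact/esym/vol_convex_body.
rewrite (fubini_tonelli (fun p : 'rV[R]_n * 'rV[R]_n => F p.1 p.2))//=.
under eq_integral => y _.
  rewrite /F; under eq_integral do rewrite EFinM addrC.
  rewrite ge0_integralZr ?lee_fin//; last first.
    apply/measurable_EFinP.
    have mp : measurable_fun setT (fun z : 'rV[R]_n => z + y).
      exact: measurable_fun_rVD.
    exact: (measurable_fun_indic_comp mK mp).
  rewrite (ge0_integral_rV_translate y (F := fun z => (\1_K z)%:E))//; last first.
    exact/measurable_EFinP/measurable_indic.
  rewrite EK.
  over.
rewrite /= ge0_integralZl//; first by rewrite EK -EFinM expr2.
- exact/measurable_EFinP.
- by rewrite lee_fin /vol fine_ge0.
Qed.

End covariogram.

(** * Euclidean norm and unit sphere *)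

Section enorm_theory.
Context {R : realType} {n : nat}.
Implicit Types x y u : 'rV[R]_n.

Lemma dotpC x y : dotp x y = dotp y x.
Proof. by apply: eq_bigr => i _; rewrite mulrC. Qed.

Lemma dotpZl (k : R) x y : dotp (k *: x) y = k * dotp x y.
Proof. by rewrite /dotp mulr_sumr; apply: eq_bigr => i _; rewrite mxE mulrA. Qed.

Lemma dotpZr (k : R) x y : dotp x (k *: y) = k * dotp x y.
Proof. by rewrite dotpC dotpZl dotpC. Qed.

Lemma dotp0 x : dotp 0 x = 0.
Proof. by rewrite /dotp big1// => i _; rewrite mxE mul0r. Qed.

Lemma dotp_ge0 x : 0 <= dotp x x.
Proof. by apply: sumr_ge0 => i _; rewrite -expr2 sqr_ge0. Qed.

Lemma enorm_ge0 x : 0 <= enorm x.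
Proof. exact: sqrtr_ge0. Qed.

Lemma sqr_coord_le_dotp x i : x ord0 i ^+ 2 <= dotp x x.
Proof.
rewrite /dotp (bigD1 i)//= -expr2 lerDl; apply: sumr_ge0 => j _.
by rewrite -expr2 sqr_ge0.
Qed.

Lemma coord_le_enorm x i : `|x ord0 i| <= enorm x.
Proof. by rewrite -sqrtr_sqr ler_wsqrtr// sqr_coord_le_dotp. Qed.

Lemma enorm0 : enorm (0 : 'rV[R]_n) = 0.
Proof. by rewrite /enorm dotp0 sqrtr0. Qed.

Lemma enorm_eq0 x : (enorm x == 0) = (x == 0).
Proof.
apply/idP/eqP => [/eqP x0|->]; last by rewrite enorm0.
apply/rowP => i; rewrite mxE; apply/eqP; rewrite -normr_le0 -x0.
exact: coord_le_enorm.
Qed.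

Lemma enorm_gt0 x : (0 < enorm x) = (x != 0).
Proof. by rewrite lt_neqAle enorm_ge0 andbT eq_sym enorm_eq0. Qed.

Lemma enormZ (k : R) x : enorm (k *: x) = `|k| * enorm x.
Proof.
rewrite /enorm dotpZl dotpZr mulrA -expr2 sqrtrM ?sqr_ge0//.
by rewrite sqrtr_sqr.
Qed.

Lemma usphere_normalize x : x != 0 -> usphere ((enorm x)^-1 *: x).
Proof.
move=> x0; rewrite /usphere/= enormZ ger0_norm ?invr_ge0 ?enorm_ge0//.
by rewrite mulVf// enorm_eq0.
Qed.

Lemma usphere_neq0 u : usphere u -> u != 0.
Proof. by move=> u1; rewrite -enorm_eq0 u1 oner_eq0. Qed.

Lemma usphere_coord_le1 u i : usphere u -> `|u ord0 i| <= 1.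
Proof. by move=> <-; exact: coord_le_enorm. Qed.

(** If all coordinates were below [1 / n], so would be their squares, which would sum to less than
    [1]. This is the uniform lower bound that [slab_upper] asks of a direction. *)
Lemma usphere_coord_ge u : usphere u -> exists i, n%:R^-1 <= `|u ord0 i|.
Proof.
move=> u1; apply: contrapT => /forallNP h.
have : dotp u u = 1.
  by rewrite -[dotp u u]sqr_sqrtr ?dotp_ge0// -/(enorm u) u1 expr1n.
apply/eqP; rewrite lt_eqF//.
have n0 : (0 < n)%N.
  have [i _] : exists i : 'I_n, u ord0 i != 0.
    apply: contrapT => /forallNP u0; move/eqP: (usphere_neq0 u1); apply.
    by apply/rowP => i; rewrite mxE; apply/eqP/negPn/negP/u0.
  by case: i => k; case: n.
have nR : (1 : R) <= n%:R by rewrite ler1n.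
apply: (@lt_le_trans _ _ (\sum_(i < n) n%:R^-1)); last first.
  by rewrite sumr_const card_ord -[X in X <= _]mulr_natl mulfV ?pnatr_eq0 -?lt0n.
apply: ltr_sum => [|i _].
  by apply/hasP; exists (Ordinal n0) => //; rewrite mem_index_enum.
have /negP := h i; rewrite -ltNge => ui.
rewrite -expr2 -real_normK ?num_real//.
apply: (@le_lt_trans _ _ `|u ord0 i|) => //.
rewrite expr2 ler_piMl// (le_trans (ltW ui))// invf_le1//.
by rewrite (lt_le_trans _ nR).
Qed.

Lemma norm_dotp_le (D : R) x u : 0 <= D -> rV_box D x -> usphere u ->
  `|dotp x u| <= n%:R * D.
Proof.
move=> D0 xD u1; apply: (le_trans (ler_norm_sum _ _ _)).
apply: (@le_trans _ _ (\sum_(i < n) D)); last first.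
  by rewrite sumr_const card_ord mulr_natl.
apply: ler_sum => i _; rewrite normrM -[leRHS]mulr1.
by rewrite ler_pM//; exact: usphere_coord_le1.
Qed.

Lemma enorm_le_box (D : R) x : 0 <= D -> rV_box D x -> enorm x <= n%:R * D.
Proof.
move=> D0 xD; have [->|x0] := eqVneq x 0; first by rewrite enorm0 mulr_ge0.
have := norm_dotp_le D0 xD (usphere_normalize x0); rewrite dotpZr.
have e0 := enorm_gt0 x; rewrite x0 in e0.
rewrite -[dotp x x]sqr_sqrtr ?dotp_ge0// -/(enorm x) expr2 mulKf ?gt_eqF//.
by rewrite ger0_norm// ltW.
Qed.

End enorm_theory.

Lemma measurable_fun_powR d (T : measurableType d) (R : realType) (f : T -> R)
    (p : R) :
  measurable_fun setT f -> measurable_fun setT (fun t => f t `^ p).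
Proof. by move=> mf; exact: (measurableT_comp (measurable_powR p) mf). Qed.

(** * Polar coordinates without a surface measure *)

Section polar_coordinates.
Context {R : realType} {n : nat}.
Local Open Scope ereal_scope.
Local Notation lam := (rV_lebesgue R n).
Local Notation mu := (@lebesgue_measure R).

Lemma ge0_integral_rV_dilate (r : R) (F : 'rV[R]_n -> \bar R) : (0 < r)%R ->
  measurable_fun setT F -> (forall x, 0 <= F x) ->
  \int[lam]_x F x = \int[lam]_x ((r ^+ n)%:E * F (r *: x)%R).
Proof.
move=> r0 mF F0.
have mFr : measurable_fun setT (fun x : 'rV[R]_n => F (r *: x)%R).
  by apply: (measurableT_comp mF); exact: measurable_fun_rVZ.
rewrite ge0_integralZl_EFin//; last by rewrite exprn_ge0// ltW.
rewrite ge0_integral_rV_scale// muleA -EFinM -exprMn mulfV ?gt_eqF//.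
by rewrite expr1n mul1e.
Qed.

Definition itv_pos : set R := `]0%R, +oo[%classic.

Lemma measurable_itv_pos : measurable itv_pos.
Proof. exact: measurable_itv. Qed.

Lemma itv_posE (r : R) : itv_pos r = (0 < r)%R :> Prop.
Proof. by rewrite /itv_pos/= in_itv/= andbT. Qed.

Definition radial_fun (a : R) (G : 'rV[R]_n -> R) (y : 'rV[R]_n) (r : R) : R :=
  (\1_itv_pos r * (G (r *: y) * r `^ (a - 1)))%R.

(** The Mellin transform of [G] along the ray of [y]. It is taken at every [y], not only on the
    sphere, because it will be integrated over a shell of positive measure. *)
Definition radial_moment (a : R) (G : 'rV[R]_n -> R) (y : 'rV[R]_n) : \bar R :=
  \int[mu]_r (radial_fun a G y r)%:E.

Section fixed_G.
Variables (a : R) (G : 'rV[R]_n -> R).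
Hypothesis mG : measurable_fun setT G.
Hypothesis G0 : forall x, (0 <= G x)%R.

Lemma radial_fun_ge0 y r : (0 <= radial_fun a G y r)%R.
Proof. by rewrite !mulr_ge0// powR_ge0. Qed.

Lemma measurable_radial_fun2 :
  measurable_fun setT (fun p : 'rV[R]_n * measurableTypeR R => radial_fun a G p.1 p.2).
Proof.
apply: measurable_funM.
  apply: measurable_fun_indic_comp => //; exact: measurable_itv_pos.
apply: measurable_funM.
  apply: (measurableT_comp mG).
  exact: (@measurable_fun_rVZ _ _ ('rV[R]_n * measurableTypeR R)%type).
exact: measurable_fun_powR.
Qed.

Lemma measurable_radial_fun y : measurable_fun setT (radial_fun a G y).
Proof. exact: (measurableT_comp measurable_radial_fun2 (pair1_measurable y)). Qed.

Lemma radial_moment_ge0 y : 0 <= radial_moment a G y.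
Proof. by apply: integral_ge0 => r _; rewrite lee_fin radial_fun_ge0. Qed.

Lemma measurable_radial_moment : measurable_fun setT (radial_moment a G).
Proof.
apply: (@measurable_fun_fubini_tonelli_F _ _ _ _ _ mu
  (fun p : 'rV[R]_n * measurableTypeR R => (radial_fun a G p.1 p.2)%:E)) => [|p].
  by apply/measurable_EFinP; exact: measurable_radial_fun2.
by rewrite lee_fin radial_fun_ge0.
Qed.

Lemma radial_momentZ (s : R) y : (0 < s)%R ->
  radial_moment a G (s *: y) = (s `^ (- a))%:E * radial_moment a G y.
Proof.
move=> s0.
have mF : measurable_fun setT (fun r : R => (radial_fun a G y r)%:E).
  by apply/measurable_EFinP; exact: measurable_radial_fun.
have F0 r : 0 <= (radial_fun a G y r)%:E by rewrite lee_fin radial_fun_ge0.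
have := @ge0_integral_affine_gt0 R 0 s _ s0 mF F0.
rewrite -/(radial_moment a G y) => E.
have {}E : (s `^ (a - 1))%:E * radial_moment a G (s *: y) =
    (s^-1)%:E * radial_moment a G y.
  rewrite -E -ge0_integralZl_EFin//; last 3 first.
  - by move=> r _; rewrite lee_fin radial_fun_ge0.
  - apply/measurable_EFinP.
    exact: (measurableT_comp measurable_radial_fun2 (pair1_measurable (s *: y))).
  - exact: powR_ge0.
  apply: eq_integral => r _; rewrite -EFinM add0r; congr EFin.
  rewrite /radial_fun !indicE.
  have -> : (s * r \in itv_pos)%R = (r \in itv_pos).
    by apply/idP/idP; rewrite !inE !itv_posE pmulr_rgt0.
  have [/[!inE]|_] := boolP (r \in itv_pos); last by rewrite !mul0r mulr0.
  rewrite itv_posE => r0; rewrite !mul1r scalerA (mulrC r) powRM ?ltW//.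
  by rewrite mulrCA.
have -> : radial_moment a G (s *: y) =
    (s `^ (- (a - 1)))%:E * ((s `^ (a - 1))%:E * radial_moment a G (s *: y)).
  by rewrite muleA -EFinM powRN mulVf ?mul1e// gt_eqF// powR_gt0.
rewrite E muleA -EFinM; congr (_%:E * _).
rewrite -powR_inv1 ?ltW// -powRD; last by rewrite (gt_eqF s0) implybT.
by congr (_ `^ _)%R; ring.
Qed.

End fixed_G.

(** The weight [1 / |x|] makes [shell (x / r) / r] equal to [1 / |x|] for [r] between [|x| / 2] and
    [|x|], and [0] for other positive [r], so its integral over [r] is [1 / 2] for every nonzero
    [x]. *)
Definition shell (x : 'rV[R]_n) : R :=
  (\1_`[1, 2]%classic (enorm x) * (enorm x) `^ (- 1))%R.

Lemma shell_ge0 x : (0 <= shell x)%R.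
Proof. by rewrite mulr_ge0// powR_ge0. Qed.

Lemma measurable_shell d (T : measurableType d) (f : T -> 'rV[R]_n) :
  measurable_fun setT f -> measurable_fun setT (fun t => shell (f t)).
Proof.
move=> mf; apply: measurable_funM.
  by apply: measurable_fun_indic_comp; [exact: measurable_itv|exact: measurable_fun_enorm].
by apply: measurable_fun_powR; exact: measurable_fun_enorm.
Qed.

Definition shell_fun (x : 'rV[R]_n) (r : R) : R :=
  (\1_itv_pos r * (shell (r `^ (- 1) *: x) * r `^ (- 1)))%R.

Lemma integral_shell x : x != 0%R ->
  \int[mu]_r (shell_fun x r)%:E = (2^-1)%:E.
Proof.
move=> x0; have N0 : (0 < enorm x)%R by rewrite enorm_gt0.
set N := enorm x in N0 *.
pose I : set (measurableTypeR R) := `[(N / 2)%R, N]%classic.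
have mI : measurable I by exact: measurable_itv.
transitivity (\int[mu]_r ((N^-1)%:E * (\1_I r)%:E)).
  apply: eq_integral => r _; rewrite -EFinM; congr EFin; rewrite /shell_fun !indicE.
  have [r0|r0] := ltP 0%R r.
    rewrite (@mem_set _ itv_pos) ?itv_posE// mul1r /shell enormZ ger0_norm ?powR_ge0// -/N.
    rewrite powR_inv1 ?ltW// indicE.
    have -> : ((r^-1 * N)%R \in `[1%R, 2%R]%classic) = (r \in I).
      apply/idP/idP; rewrite !inE /I/= !in_itv/= (mulrC r^-1%R) ler_pdivlMr// mul1r;
        by rewrite !ler_pdivrMr// (mulrC 2%R) andbC.
    case: (_ \in _); last by rewrite !mul0r mulr0.
    rewrite mul1r mulr1 powR_inv1 ?mulr_ge0 ?invr_ge0 ?ltW//.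
    by rewrite invfM invrK; field; rewrite !gt_eqF.
  rewrite (@memNset _ itv_pos); last by rewrite itv_posE; apply/negP; rewrite -leNgt.
  rewrite mul0r memNset ?mulr0// /I/=; rewrite in_itv/= => /andP[rN _].
  by move: r0; apply/negP; rewrite -ltNge; apply: lt_le_trans rN; rewrite divr_gt0.
rewrite ge0_integralZl_EFin//; last 2 first.
- by apply/measurable_EFinP; exact: measurable_indic.
- by rewrite invr_ge0 ltW.
rewrite integral_indic// setIT.
transitivity ((N^-1)%:E * mu I); first by [].
rewrite /I lebesgue_measure_itv/= lte_fin ltr_pdivrMr// ltr_pMr// ltr1n.
by rewrite -EFinB -EFinM; congr EFin; field; rewrite gt_eqF.
Qed.

Lemma measurable_shell_fun2 :
  measurable_fun setT (fun p : 'rV[R]_n * measurableTypeR R => shell_fun p.1 p.2).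
Proof.
have mp : measurable_fun setT
    (fun p : 'rV[R]_n * measurableTypeR R => p.2 `^ (- 1))%R.
  exact: measurable_fun_powR.
apply: measurable_funM.
  apply: measurable_fun_indic_comp => //; exact: measurable_itv_pos.
apply: measurable_funM => //; apply: measurable_shell.
exact: (@measurable_fun_rVZ _ _ ('rV[R]_n * measurableTypeR R)%type).
Qed.

Lemma shell_fun_ge0 x r : (0 <= shell_fun x r)%R.
Proof. by rewrite !mulr_ge0 ?shell_ge0 ?powR_ge0. Qed.

(* Averaging over the dilates of the shell [1 <= |x| <= 2] replaces the
   integration over the sphere. *)
Lemma polar_coordinates (q : R) (f G : 'rV[R]_n -> R) :
  measurable_fun setT f -> (forall x, (0 <= f x)%R) -> f 0%R = 0%R ->
  (forall r x, (0 < r)%R -> f (r *: x) = (r `^ q * f x)%R) ->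
  measurable_fun setT G -> (forall x, (0 <= G x)%R) ->
  \int[lam]_x (f x * G x)%:E =
  2%:E * \int[lam]_y ((f y * shell y)%:E * radial_moment (n%:R + q) G y).
Proof.
move=> mf f0 f00 fZ mG G0.
(* Inserts the constant [1] as twice the integral of [shell_fun]; at the origin, which that formula
   excludes, [f] vanishes. *)
transitivity (\int[lam]_x (2%:E * \int[mu]_r (f x * G x * shell_fun x r)%:E)).
  apply: eq_integral => x _.
  under eq_integral do rewrite EFinM.
  rewrite ge0_integralZl_EFin ?mulr_ge0//; last 2 first.
  - by move=> r _; rewrite lee_fin shell_fun_ge0.
  - apply/measurable_EFinP.
    exact: (measurableT_comp measurable_shell_fun2 (pair1_measurable x)).
  have [->|x0] := eqVneq x 0%R; first by rewrite f00 mul0r mul0e mule0.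
  by rewrite integral_shell// muleC -EFinM -mulrA mulVf// mulr1.
have mFG : measurable_fun setT (fun p : 'rV[R]_n * measurableTypeR R =>
    (f p.1 * G p.1 * shell_fun p.1 p.2)%:E).
  apply/measurable_EFinP; apply: measurable_funM; last exact: measurable_shell_fun2.
  by apply: measurable_funM; [exact: (measurableT_comp mf)|exact: (measurableT_comp mG)].
have FG0 x r : (0 <= f x * G x * shell_fun x r)%R.
  by rewrite mulr_ge0 ?shell_fun_ge0// mulr_ge0.
have mH : measurable_fun setT (fun p : 'rV[R]_n * measurableTypeR R =>
    (f p.1 * shell p.1 * radial_fun (n%:R + q) G p.1 p.2)%:E).
  apply/measurable_EFinP; apply: measurable_funM; last exact: measurable_radial_fun2.
  by apply: measurable_funM; [exact: (measurableT_comp mf)|exact: measurable_shell].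
have H0 x r : (0 <= f x * shell x * radial_fun (n%:R + q) G x r)%R.
  by rewrite mulr_ge0 ?radial_fun_ge0// mulr_ge0 ?shell_ge0.
rewrite ge0_integralZl_EFin//; last 2 first.
- by move=> x _; apply: integral_ge0 => r _; rewrite lee_fin.
- apply: (@measurable_fun_fubini_tonelli_F _ _ _ _ _ mu
    (fun p : 'rV[R]_n * measurableTypeR R => (f p.1 * G p.1 * shell_fun p.1 p.2)%:E)) => // p.
  by rewrite lee_fin.
congr (_ * _).
rewrite (@fubini_tonelli _ _ _ _ _ lam mu (fun p : 'rV[R]_n * measurableTypeR R =>
    (f p.1 * G p.1 * shell_fun p.1 p.2)%:E))//=; last by move=> p; rewrite lee_fin.
transitivity (\int[mu]_r \int[lam]_y (f y * shell y * radial_fun (n%:R + q) G y r)%:E).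
  apply: eq_integral => r _.
  have [r0|r0] := ltP 0%R r; last first.
    rewrite !integral0_eq// => y _;
    rewrite /shell_fun /radial_fun indicE memNset ?mul0r ?mulr0//;
    by rewrite itv_posE; apply/negP; rewrite -leNgt.
  pose F x := (f x * G x * shell_fun x r)%R.
  have mF : measurable_fun setT (fun x => (F x)%:E).
    exact: (measurableT_comp mFG (pair2_measurable r)).
  have F0 x : 0 <= (F x)%:E by rewrite lee_fin FG0.
  (* For fixed [r], the dilation by [r] yields [r ^+ n], homogeneity of [f] the power [q] of [r],
     and [shell_fun] a factor [1 / r]: the total exponent is [n + q - 1]. *)
  rewrite (ge0_integral_rV_dilate r0 mF F0).
  apply: eq_integral => y _; rewrite -EFinM; congr EFin.
  rewrite /F fZ// /shell_fun /radial_fun scalerA powR_inv1 ?ltW// mulVf ?gt_eqF// scale1r.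
  have -> : (r `^ (n%:R + q - 1) = r ^+ n * r `^ q * r^-1)%R.
    rewrite -addrA powRD ?(gt_eqF r0) ?implybT// powR_mulrn ?(ltW r0)//.
    by rewrite powRD ?(gt_eqF r0) ?implybT// powR_inv1 ?(ltW r0)// mulrA.
  by ring.
transitivity (\int[lam]_y \int[mu]_r
    (f y * shell y * radial_fun (n%:R + q) G y r)%:E).
  apply/esym; apply: (@fubini_tonelli _ _ _ _ _ lam mu
    (fun p : 'rV[R]_n * measurableTypeR R =>
      (f p.1 * shell p.1 * radial_fun (n%:R + q) G p.1 p.2)%:E)) => // p.
  by rewrite lee_fin.
apply: eq_integral => y _.
under eq_integral do rewrite EFinM.
have fs0 : (0 <= f y * shell y)%R by apply: mulr_ge0 => //; exact: shell_ge0.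
rewrite ge0_integralZl_EFin//.
- by move=> r _; rewrite lee_fin radial_fun_ge0.
- apply/measurable_EFinP.
  exact: (measurableT_comp (measurable_radial_fun2 _ mG) (pair1_measurable y)).
Qed.

End polar_coordinates.

(** * Power integrals over a symmetric interval *)

Section power_integrals.
Context {R : realType}.
Local Open Scope ereal_scope.
Local Notation mu := (@lebesgue_measure R).

Definition cut_powR (a E t : R) : R := (\1_`]0%R, E]%classic t * t `^ (a - 1))%R.

Lemma cut_powR_ge0 a E t : (0 <= cut_powR a E t)%R.
Proof. by rewrite mulr_ge0// powR_ge0. Qed.

Lemma measurable_cut_powR a E : measurable_fun setT (cut_powR a E).
Proof.
apply: measurable_funM; last exact: measurable_powR.
by apply: measurable_indic; exact: measurable_itv.
Qed.

Lemma integral_cut_powR a E : (0 < a)%R -> (0 <= E)%R ->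
  \int[mu]_t (cut_powR a E t)%:E = (a^-1 * E `^ a)%:E.
Proof.
move=> a0 E0; rewrite -integral_powR_itv0c// [RHS]integral_mkcond.
apply: eq_integral => t _; rewrite patchE /cut_powR indicE.
by case: ifPn => _; rewrite ?mul1r ?mul0r.
Qed.

Lemma integral_indic_set1 (x : R) : \int[mu]_t (\1_[set x] t)%:E = 0.
Proof. by rewrite integral_indic// setIT; exact: lebesgue_measure_set1. Qed.

(** Folds the two half-lines onto []0, E]]. At [t = 0] the convention [ln 0 = 0] gives the
    exponential the value [1], whence a third summand supported at a point. *)
Lemma integral_sym_power (a E : R) : (0 < a)%R -> (0 <= E)%R ->
  \int[mu]_t ((\1_(itv_sym E) t)%:E * (expR ((a - 1) * ln `|t|))%:E) =
  (2 * (a^-1 * E `^ a))%:E.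
Proof.
move=> a0 E0.
have e t : (\1_(itv_sym E) t)%:E * (expR ((a - 1) * ln `|t|))%:E =
    (cut_powR a E t)%:E + ((cut_powR a E (- t))%:E + (\1_[set 0%R] t)%:E).
  rewrite -EFinM -!EFinD; congr EFin; rewrite /cut_powR !indicE.
  have s : (t \in itv_sym E) = (`|t| <= E)%R.
    by apply/idP/idP; rewrite inE.
  have p (r : R) : (r \in `]0%R, E]%classic) = (0 < r <= E)%R.
    by apply/idP/idP; rewrite inE/= in_itv.
  have z : (t \in [set 0%R]) = (t == 0%R).
    by apply/idP/eqP; rewrite inE.
  rewrite s !p z; have [t0|t0|->] := ltgtP t 0%R.
  - rewrite ltr0_norm// oppr_gt0 t0/= mul0r add0r addr0 /powR oppr_eq0 lt_eqF//.
  - rewrite gtr0_norm//= oppr_gt0 ltNge (ltW t0)/= mul0r !addr0 /powR gt_eqF//.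
  - by rewrite oppr0 normr0 E0 ltxx/= !mul0r ln0// mulr0 expR0 !add0r mulr1.
under eq_integral do rewrite e.
have mc := measurable_cut_powR a E.
have mcN : measurable_fun setT (fun t : R => cut_powR a E (- t)).
  by apply: (measurableT_comp mc).
have m1 : measurable_fun setT (fun t : R => \1_[set 0%R] t : R).
  by apply: measurable_indic.
rewrite ge0_integralD//; last 4 first.
- by move=> t _; rewrite lee_fin cut_powR_ge0.
- exact/measurable_EFinP.
- by move=> t _; rewrite adde_ge0// lee_fin cut_powR_ge0.
- by apply: emeasurable_funD; exact/measurable_EFinP.
rewrite ge0_integralD//; last 3 first.
- by move=> t _; rewrite lee_fin cut_powR_ge0.
- exact/measurable_EFinP.
- exact/measurable_EFinP.
rewrite (ge0_integral_oppT (h := fun t => (cut_powR a E t)%:E)); last 2 first.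
- exact/measurable_EFinP.
- by move=> t; rewrite lee_fin cut_powR_ge0.
rewrite integral_cut_powR// integral_indic_set1.
by rewrite adde0 -EFinD; congr EFin; ring.
Qed.

End power_integrals.

(** * The normalised covariogram as a probability density *)

Section weight.
Context {R : realType} {n : nat}.
Hypothesis n0 : (0 < n)%N.
Local Notation lam := (rV_lebesgue R n).
Local Notation mu := (@lebesgue_measure R).
Variable K : set 'rV[R]_n.
Hypothesis cbK : convex_body K.

Definition cweight (z : 'rV[R]_n) : R := covariogram K z / vol K ^+ 2.

Definition log_dotp (u z : 'rV[R]_n) : R := ln `|dotp z u|.

Let V0 : 0 < vol K. Proof. exact: vol_convex_body_gt0. Qed.

Lemma cweight_ge0 z : 0 <= cweight z.
Proof. by rewrite divr_ge0 ?covariogram_ge0// exprn_ge0// ltW. Qed.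

Lemma measurable_cweight : measurable_fun setT cweight.
Proof. by apply: measurable_funM => //; exact: measurable_covariogram. Qed.

Lemma integral_cweight : (\int[lam]_z (cweight z)%:E)%E = 1%E.
Proof.
under eq_integral do rewrite /cweight mulrC EFinM.
rewrite ge0_integralZl_EFin//.
- by rewrite integral_covariogram// -EFinM mulVf// expf_neq0// gt_eqF.
- by move=> z _; rewrite lee_fin covariogram_ge0.
- by apply/measurable_EFinP; exact: measurable_covariogram.
- by rewrite invr_ge0 exprn_ge0// ltW.
Qed.

Lemma cweight_le z : cweight z <= (vol K)^-1.
Proof.
rewrite /cweight expr2 invfM mulrA ler_piMl ?invr_ge0 ?(ltW V0)//.
by rewrite ler_pdivrMr// mul1r covariogram_le_vol.
Qed.

Lemma cweight_supp z : cweight z != 0 -> diff_body K z.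
Proof.
move=> wz; apply: covariogram_supp; apply: contraNneq wz => g0.
by rewrite /cweight g0 mul0r.
Qed.

Definition dotp_integral u (h : R -> \bar R) : \bar R :=
  \int[lam]_z (h (dotp z u) * (cweight z)%:E).

Lemma measurable_dotp_integrand u (h : R -> \bar R) : measurable_fun setT h ->
  measurable_fun setT (fun z => h (dotp z u) * (cweight z)%:E)%E.
Proof.
move=> mh; apply: emeasurable_funM.
  by apply: (measurableT_comp mh); exact: measurable_fun_dotp.
by apply/measurable_EFinP; exact: measurable_cweight.
Qed.

Section bounded.
Variable D : R.
Hypothesis D0 : 0 < D.
Hypothesis DK : diff_body K `<=` rV_box D.

Lemma cweight_dotp_le u z : usphere u -> cweight z != 0 ->
  `|dotp z u| <= n%:R * D.
Proof. by move=> u1 /cweight_supp/DK zD; apply: norm_dotp_le => //; exact: ltW. Qed.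

(** The density is at most [(vol K)^-1] and vanishes off a cube; [slab_upper] with [dl = 1 / n] then
    gives a constant independent of [u]. *)
Lemma dotp_integral_upper : exists2 C : R, 0 <= C &
  forall u (h : R -> \bar R), usphere u -> measurable_fun setT h ->
    (forall t, 0 <= h t)%E ->
    (dotp_integral u h <=
     C%:E * \int[mu]_t ((\1_(itv_sym (n%:R * D)) t)%:E * h t))%E.
Proof.
have ni : (0 : R) < n%:R^-1 by rewrite invr_gt0 ltr0n.
have [C C0 HC] := slab_upper n (ltW D0) ni.
exists ((vol K)^-1 * C); first by rewrite mulr_ge0 ?invr_ge0 ?(ltW V0).
move=> u h u1 mh h0.
pose h' t := ((\1_(itv_sym (n%:R * D)) t)%:E * h t)%E.
have h'0 t : (0 <= h' t)%E by rewrite mule_ge0// lee_fin.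
have mh' : measurable_fun setT h'.
  apply: emeasurable_funM => //.
  by apply/measurable_EFinP/measurable_indic; exact: measurable_itv_sym.
rewrite EFinM -muleA.
have Vi : (0 <= (vol K)^-1%:E)%E by rewrite lee_fin invr_ge0 ltW.
apply: le_trans (lee_wpmul2l Vi (HC u 0 h' (usphere_coord_ge u1) mh' h'0)).
rewrite -ge0_integralZl_EFin//; last 2 first.
- by move=> x _; exact: slab_fun_ge0.
- exact: measurable_slab_fun.
apply: ge0_le_integral => //.
- by move=> z _; rewrite mule_ge0// lee_fin cweight_ge0.
- exact: measurable_dotp_integrand.
- by apply: measurable_funeM; exact: measurable_slab_fun.
move=> z _; have [->|wz] := eqVneq (cweight z) 0.
  by rewrite mule0 mule_ge0//; exact: slab_fun_ge0.
rewrite /slab_fun /h' add0r !indicE !mem_set ?mul1e.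
- by rewrite muleC lee_wpmul2r// lee_fin cweight_le.
- exact: cweight_dotp_le.
- exact/DK/cweight_supp.
Qed.

End bounded.

(** Hyperplanes through the origin are null for the weight, which makes the conventions for [ln 0]
    and for powers of [0] harmless. *)
Lemma dotp_integral_eq0 u : usphere u ->
  dotp_integral u (fun t => (\1_[set 0%R] t)%:E) = 0%E.
Proof.
move=> u1; have [D D0 DK] := diff_body_bounded cbK.
have [C C0 HC] := dotp_integral_upper D0 DK.
have m1 : measurable_fun setT (fun t : R => (\1_[set 0%R] t)%:E : \bar R).
  by apply/measurable_EFinP; exact: measurable_indic.
apply/eqP; rewrite eq_le; apply/andP; split; last first.
  by apply: integral_ge0 => z _; rewrite mule_ge0// lee_fin// cweight_ge0.
have h0 (t : R) : (0 <= (\1_[set 0%R] t)%:E :> \bar R)%E by rewrite lee_fin.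
apply: (le_trans (HC u _ u1 m1 h0)).
suff -> : (\int[mu]_t ((\1_(itv_sym (n%:R * D)) t)%:E * (\1_[set 0%R] t)%:E) = 0)%E.
  by rewrite mule0.
apply/eqP; rewrite eq_le; apply/andP; split; last first.
  by apply: integral_ge0 => t _; rewrite mule_ge0// lee_fin.
apply: (@le_trans _ _ (\int[mu]_t (\1_[set 0%R] t)%:E)%E).
  apply: ge0_le_integral => //.
  - apply: emeasurable_funM => //.
    by apply/measurable_EFinP/measurable_indic; exact: measurable_itv_sym.
  - by move=> t _; rewrite -EFinM lee_fin -[leRHS]mul1r ler_wpM2r// indicE lern1 leq_b1.
by rewrite integral_indic_set1.
Qed.

(** The estimate comes from a neighbourhood of the origin, where [g_K] is bounded below. The
    constants depend on [u], which suits the pointwise limit at [-1]. *)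
Lemma dotp_integral_lower u : usphere u -> exists2 eta : R, 0 < eta &
  exists2 c : R, 0 < c & forall (h : R -> \bar R), measurable_fun setT h ->
    (forall t, 0 <= h t)%E ->
    (c%:E * \int[mu]_t ((\1_(itv_sym eta) t)%:E * h t) <= dotp_integral u h)%E.
Proof.
move=> u1; have [e e0 [c c0 gc]] := covariogram_near0 cbK.
have uj : exists j, u ord0 j != 0.
  have [j uj] := usphere_coord_ge u1; exists j; rewrite -normr_gt0.
  by rewrite (lt_le_trans _ uj)// invr_gt0 ltr0n.
have [eta eta0 [c1 c10 H]] := slab_lower e0 uj.
exists eta => //; exists (c / vol K ^+ 2 * c1).
  by rewrite mulr_gt0// divr_gt0// exprn_gt0.
move=> h mh h0.
have cV : 0 <= c / vol K ^+ 2 by rewrite ltW// divr_gt0// exprn_gt0.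
have eta0' : `|0 : R| <= eta by rewrite normr0 ltW.
rewrite EFinM -muleA.
apply: (le_trans (lee_wpmul2l _ (H 0 h eta0' mh h0))); first by rewrite lee_fin.
rewrite -ge0_integralZl_EFin//; last 2 first.
- by move=> x _; exact: slab_fun_ge0.
- exact: measurable_slab_fun.
apply: ge0_le_integral => //.
- by move=> z _; rewrite mule_ge0 ?lee_fin//; exact: slab_fun_ge0.
- by apply: measurable_funeM; exact: measurable_slab_fun.
- exact: measurable_dotp_integrand.
move=> z _; rewrite /slab_fun indicE add0r.
have [/[!inE] ze|_] := boolP (_ \in _); last first.
  by rewrite mul0e mule0 mule_ge0// lee_fin cweight_ge0.
rewrite mul1e muleC lee_wpmul2l// lee_fin ler_wpM2r ?invr_ge0 ?exprn_ge0 ?(ltW V0)//.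
exact: gc.
Qed.

Lemma measurable_log_dotp u : measurable_fun setT (log_dotp u).
Proof.
apply: measurableT_comp => //; apply: measurableT_comp => //.
exact: measurable_fun_dotp.
Qed.

(** The power [|t|^q], but with value [1] at [t = 0]: composed with [dotp] it is exactly the
    exponential of [q] times [log_dotp], so no exceptional set enters the log-moments. *)
Definition log_pow (q t : R) : \bar R := (expR (q * ln `|t|))%:E.

Lemma measurable_log_pow q : measurable_fun setT (log_pow q).
Proof.
apply/measurable_EFinP; apply: measurableT_comp => //.
apply: measurable_funM => //; apply: measurableT_comp => //.
Qed.

Lemma log_pow_ge0 q t : (0 <= log_pow q t)%E.
Proof. by rewrite lee_fin expR_ge0. Qed.

Lemma dotp_integral_log_pow q u : dotp_integral u (log_pow q) =
  (\int[lam]_z (expR (q * log_dotp u z) * cweight z)%:E)%E.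
Proof. by []. Qed.

Lemma dotp_integral_log_pow_bounded q : -1 < q ->
  exists A : R, forall u, usphere u -> (dotp_integral u (log_pow q) <= A%:E)%E.
Proof.
move=> q1; have [D D0 DK] := diff_body_bounded cbK.
have [C C0 HC] := dotp_integral_upper D0 DK.
exists (C * (2 * ((q + 1)^-1 * (n%:R * D) `^ (q + 1)))) => u u1.
apply: (le_trans (HC u _ u1 (measurable_log_pow q) (log_pow_ge0 q))).
rewrite EFinM; have q1' : 0 < q + 1 by lra.
have nD : 0 <= n%:R * D by rewrite mulr_ge0 ?(ltW D0).
by rewrite -(integral_sym_power q1' nD) /log_pow addrK.
Qed.

Lemma tame_cweight : exists b, forall u, usphere u ->
  tame lam cweight (log_dotp u) b.
Proof.
have [D D0 DK] := diff_body_bounded cbK.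
(* Adding [1] makes the bound nonnegative: on the hyperplane [dotp z u = 0] the convention gives
   [log_dotp u z = 0], which must be bounded too. *)
exists (ln (1 + n%:R * D)) => u u1; split.
- exact: measurable_cweight.
- exact: cweight_ge0.
- exact: integral_cweight.
- exact: measurable_log_dotp.
- move=> z wz; rewrite /log_dotp.
  have nD : 0 <= n%:R * D by rewrite mulr_ge0 ?(ltW D0).
  have := cweight_dotp_le D0 DK u1 wz.
  have [->|d0 dD] := eqVneq `|dotp z u| 0.
    by rewrite ln0// => _; rewrite ln_ge0// lerDl.
  rewrite ler_ln ?posrE ?lt0r ?d0 ?normr_ge0//; first by rewrite (le_trans dD)// lerDr.
  by rewrite addr_ge0// andbT gt_eqF// ltr_pwDl.
- move=> a /andP[a1 _]; have [A HA] := dotp_integral_log_pow_bounded a1.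
  by apply: le_lt_trans (HA u u1) _; rewrite ltry.
Qed.

Lemma wmean_log_dotp_bounded q : -1 < q -> exists A : R, forall u, usphere u ->
  wmean lam cweight (fun z => expR (q * log_dotp u z)) <= A.
Proof.
move=> q1; have [A HA] := dotp_integral_log_pow_bounded q1.
exists A => u u1; rewrite /wmean /Rintegral -dotp_integral_log_pow.
have I0 : (0 <= dotp_integral u (log_pow q))%E.
  by apply: integral_ge0 => z _; rewrite mule_ge0 ?log_pow_ge0// lee_fin cweight_ge0.
rewrite -lee_fin fineK ?HA// ge0_fin_numE//.
by apply: le_lt_trans (HA u u1) _; rewrite ltry.
Qed.

Lemma EFin_wmean_log_dotp q u : -1 < q -> usphere u ->
  (wmean lam cweight (fun z => expR (q * log_dotp u z)))%:E =
  dotp_integral u (log_pow q).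
Proof.
move=> q1 u1; have [A HA] := dotp_integral_log_pow_bounded q1.
rewrite /wmean /Rintegral -dotp_integral_log_pow fineK// ge0_fin_numE.
  by apply: le_lt_trans (HA u u1) _; rewrite ltry.
by apply: integral_ge0 => z _; rewrite mule_ge0 ?log_pow_ge0// lee_fin cweight_ge0.
Qed.

End weight.

(** * Star-shaped sets given by radial functions *)

Section star_of_theory.
Context {R : realType} {n : nat}.
Implicit Types (x u : 'rV[R]_n).

Lemma eq_star_of (rho1 rho2 : 'rV[R]_n -> \bar R) :
  (forall u, usphere u -> rho1 u = rho2 u) -> star_of rho1 = star_of rho2.
Proof.
by move=> e; apply/seteqP; split => x [t [u [u1 t0 tu ->]]];
  exists t, u; split => //; rewrite ?e// -e.
Qed.

Lemma usphereZ_inj (t t' : R) u u' : usphere u -> usphere u' ->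
  0 < t -> 0 <= t' -> t *: u = t' *: u' -> t = t' /\ u = u'.
Proof.
move=> u1 u1' t0 t0' e.
have tt : t = t'.
  have := congr1 (@enorm R n) e; rewrite !enormZ u1 u1' !mulr1 !ger0_norm//.
  exact: ltW.
split => //; move: e; rewrite -tt => /(congr1 ( *:%R t^-1)).
by rewrite !scalerA mulVf ?gt_eqF// !scale1r.
Qed.

Lemma star_ofE (rho : 'rV[R]_n -> \bar R) x : x != 0 ->
  star_of rho x = ((enorm x)%:E <= rho ((enorm x)^-1 *: x))%E :> Prop.
Proof.
move=> x0; have N0 : 0 < enorm x by rewrite enorm_gt0.
apply/propext; split=> [[t [u [u1 t0 tu xE]]]|h]; last first.
  exists (enorm x), ((enorm x)^-1 *: x); split => //.
  - exact: usphere_normalize.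
  - exact: enorm_ge0.
  - by rewrite scalerA mulfV ?gt_eqF// scale1r.
have : enorm x *: ((enorm x)^-1 *: x) = t *: u.
  by rewrite scalerA mulfV ?gt_eqF// scale1r.
by move=> /(usphereZ_inj (usphere_normalize x0) u1 N0 t0)[-> ->].
Qed.

Lemma star_of_ray (rho : 'rV[R]_n -> \bar R) u (t : R) : usphere u -> 0 < t ->
  star_of rho (t *: u) = (t%:E <= rho u)%E :> Prop.
Proof.
move=> u1 t0.
have tu : t *: u != 0 by rewrite scaler_eq0 gt_eqF//= usphere_neq0.
have tt : t^-1 * t = 1 by rewrite mulVf// gt_eqF.
by rewrite (star_ofE _ tu) enormZ u1 mulr1 (gtr0_norm t0) scalerA tt scale1r.
Qed.

Lemma star_of0 (rho : 'rV[R]_n -> \bar R) u : usphere u -> (0 <= rho u)%E ->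
  star_of rho 0.
Proof. by move=> u1 r0; exists 0, u; split; rewrite ?scale0r. Qed.

(** In dimension [0] the sphere, and with it every [star_of], is empty; a positive dimension is what
    puts the origin into these sets. *)
Lemma exists_usphere : (0 < n)%N -> exists u, usphere u.
Proof.
move=> n0; pose x : 'rV[R]_n := const_mx 1.
have x0 : x != 0.
  apply/eqP => /rowP/(_ (Ordinal n0)); rewrite !mxE => /eqP.
  by rewrite oner_eq0.
by exists ((enorm x)^-1 *: x); exact: usphere_normalize.
Qed.

Lemma scale_star_of (s : R) (rho : 'rV[R]_n -> R) : 0 < s ->
  [set s *: x | x in star_of (fun u => (rho u)%:E)] =
  star_of (fun u => (s * rho u)%:E).
Proof.
move=> s0; apply/seteqP; split => [_ [_ [t [u [u1 t0 tu ->]]] <-]|x [t [u [u1 t0 tu ->]]]].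
  exists (s * t), u; split => //; rewrite ?scalerA//; first by rewrite mulr_ge0// ltW.
  by move: tu; rewrite !lee_fin ler_pM2l.
exists (s^-1 * t *: u); last by rewrite scalerA mulrA mulfV ?gt_eqF// mul1r.
exists (s^-1 * t), u; split => //; first by rewrite mulr_ge0// invr_ge0 ltW.
by move: tu; rewrite !lee_fin ler_pdivrMl.
Qed.

End star_of_theory.

Lemma le_powRV (R : realType) (a x y : R) : 0 < a -> 0 <= x -> 0 <= y ->
  (x <= y `^ a^-1) = (x `^ a <= y).
Proof.
move=> a0 x0 y0; have ai : 0 <= a^-1 by rewrite invr_ge0 ltW.
have ak (z : R) : 0 <= z -> (z `^ a^-1) `^ a = z.
  by move=> z0; rewrite -powRrM mulVf ?gt_eqF// powRr1.
have ka (z : R) : 0 <= z -> (z `^ a) `^ a^-1 = z.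
  by move=> z0; rewrite -powRrM mulfV ?gt_eqF// powRr1.
apply/idP/idP => h.
  by rewrite -[leRHS]ak// ge0_ler_powR// ?nnegrE ?powR_ge0// ltW.
by rewrite -[leLHS]ka// ge0_ler_powR// ?nnegrE ?powR_ge0.
Qed.

(** * Radial functions of the polar mean zonoids *)

Section representation.
Context {R : realType} {n : nat}.
Hypothesis n0 : (0 < n)%N.
Local Notation lam := (rV_lebesgue R n).
Local Notation mu := (@lebesgue_measure R).
Variable K : set 'rV[R]_n.
Hypothesis cbK : convex_body K.
Let V0 : 0 < vol K. Proof. exact: vol_convex_body_gt0. Qed.

Definition zonoid_radius (q : R) (u : 'rV[R]_n) : R :=
  expR (- log_moment lam (cweight K) (log_dotp u) q).

Section radial_mean_body.
Variable a : R.
Hypothesis a0 : 0 < a.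

Let G (z : 'rV[R]_n) : R := covariogram K z / vol K.
Let G0 z : 0 <= G z. Proof. by rewrite divr_ge0 ?covariogram_ge0// ltW. Qed.
Let mG : measurable_fun setT G.
Proof. by apply: measurable_funM => //; exact: measurable_covariogram. Qed.
Let RM := radial_moment a G.
Let S := radial_mean_body a K.
Let rhoS u := (a * fine (RM u)) `^ a^-1.

Lemma radial_mean_bodyE : S = star_of (fun u => (rhoS u)%:E).
Proof.
apply: eq_star_of => u _; congr ((_ * _) `^ _)%:E.
rewrite /Rintegral /RM /radial_moment integral_mkcond; congr fine.
apply: eq_integral => r _; rewrite patchE /radial_fun indicE /itv_pos.
by case: ifPn => _; rewrite ?mul1r ?mul0r.
Qed.

Lemma radial_moment_covariogram_le (D : R) : 0 <= D -> diff_body K `<=` rV_box D ->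
  forall u, usphere u -> (RM u <= (a^-1 * (n%:R * D) `^ a)%:E)%E.
Proof.
move=> D0 DK u u1; have nD : 0 <= n%:R * D by rewrite mulr_ge0.
rewrite -(integral_cut_powR a0 nD); apply: ge0_le_integral => //.
- by move=> r _; rewrite lee_fin; exact: radial_fun_ge0.
- by apply/measurable_EFinP; exact: measurable_radial_fun.
- by apply/measurable_EFinP; exact: measurable_cut_powR.
move=> r _; rewrite lee_fin /radial_fun /cut_powR.
have [r0|r0] := ltP 0 r; last first.
  rewrite [leLHS](_ : _ = 0) ?mulr_ge0 ?powR_ge0//.
  rewrite indicE memNset ?mul0r// itv_posE; apply/negP.
  by rewrite -leNgt.
have [g0|g0] := eqVneq (covariogram K (r *: u)) 0.
  by rewrite /G g0 mul0r mul0r mulr0 mulr_ge0 ?powR_ge0.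
have : enorm (r *: u) <= n%:R * D.
  by apply: enorm_le_box => //; exact/DK/covariogram_supp.
rewrite enormZ u1 mulr1 gtr0_norm// => rD.
rewrite !indicE !mem_set ?itv_posE//=; last by rewrite in_itv/= r0 rD.
rewrite !mul1r ler_piMl ?powR_ge0// /G ler_pdivrMr// mul1r.
exact: covariogram_le_vol.
Qed.

Lemma radial_moment_fin u : usphere u -> RM u = (fine (RM u))%:E.
Proof.
move=> u1; have [D D0 DK] := diff_body_bounded cbK.
rewrite fineK// ge0_fin_numE; last exact: radial_moment_ge0.
by apply: le_lt_trans (radial_moment_covariogram_le (ltW D0) DK u1) _; rewrite ltry.
Qed.

Lemma radial_mean_body_rays u r : usphere u -> 0 < r -> S (r *: u) <-> r <= rhoS u.
Proof. by move=> u1 r0; rewrite radial_mean_bodyE star_of_ray. Qed.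

Lemma radial_mean_body_rhoS_ge0 u : 0 <= a * fine (RM u).
Proof. by rewrite mulr_ge0 ?(ltW a0)// fine_ge0//; exact: radial_moment_ge0. Qed.

(** Homogeneity of degree [- a] turns membership into a superlevel set of a measurable function,
    from which measurability of [S] follows. *)
Lemma radial_mean_body_mem x : x != 0 -> S x <-> (1%:E <= a%:E * RM x)%E.
Proof.
move=> x0; have N0 : 0 < enorm x by rewrite enorm_gt0.
pose u := (enorm x)^-1 *: x; have u1 : usphere u := usphere_normalize x0.
have xE : x = enorm x *: u by rewrite /u scalerA mulfV ?gt_eqF// scale1r.
have RMx : RM x = ((enorm x `^ (- a))%:E * RM u)%E.
  by rewrite [in LHS]xE /RM (radial_momentZ _ mG).
have Sx : S x = (enorm x <= rhoS u) :> Prop.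
  by apply/propext; rewrite -radial_mean_body_rays// -xE.
rewrite Sx RMx radial_moment_fin// /rhoS.
rewrite le_powRV ?enorm_ge0 ?radial_mean_body_rhoS_ge0//.
by rewrite -!EFinM lee_fin powRN [X in _ <-> 1 <= X]mulrCA ler_pdivlMl ?powR_gt0// mulr1.
Qed.

Lemma measurable_radial_mean_body : measurable S.
Proof.
have m0 : measurable [set 0 : 'rV[R]_n].
  apply: closed_rV_measurable; apply: compact_closed => //.
  exact: compact_set1.
rewrite (_ : S = [set 0] `|` ([set x | (1%:E <= a%:E * RM x)%E] `\ 0)).
  apply: measurableU => //; apply: measurableD => //.
  rewrite -[X in measurable X]setTI; apply: emeasurable_fun_c_infty => //.
  by apply: measurable_funeM; exact: measurable_radial_moment.
apply/seteqP; split => x.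
  move=> Sx; have [->|x0] := eqVneq x 0; first by left.
  by right; split => [/=|]; [apply/radial_mean_body_mem|exact/eqP].
move=> [->|[/= + /eqP x0]]; last by move/radial_mean_body_mem; apply.
have [u u1] := @exists_usphere R n n0.
rewrite radial_mean_bodyE; apply: star_of0 u1 _.
by rewrite lee_fin powR_ge0.
Qed.

(** In a unit direction the moment of the indicator is the [a]-th power of the radius divided by
    [a], and the radius of [S] is defined to make this the moment of [g_K / vol K]; homogeneity does
    the rest. [S] is the Ball body of [g_K / vol K]. *)
Lemma radial_moment_indic y : y != 0 -> radial_moment a \1_S y = RM y.
Proof.
move=> y0; have N0 : 0 < enorm y by rewrite enorm_gt0.
pose u := (enorm y)^-1 *: y; have u1 : usphere u := usphere_normalize y0.
have yE : y = enorm y *: u by rewrite /u scalerA mulfV ?gt_eqF// scale1r.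
have mS := measurable_radial_mean_body.
have m1 : measurable_fun setT (\1_S : 'rV[R]_n -> R) by exact: measurable_indic.
have i0 (z : 'rV[R]_n) : 0 <= (\1_S z : R) by [].
rewrite yE /RM (radial_momentZ _ m1 i0)// (radial_momentZ _ mG)//.
congr (_ * _)%E; rewrite -/(RM u) radial_moment_fin//.
have -> : fine (RM u) = a^-1 * rhoS u `^ a.
  rewrite /rhoS -powRrM mulVf ?gt_eqF// powRr1 ?radial_mean_body_rhoS_ge0//.
  by rewrite mulKf ?gt_eqF.
rewrite -integral_cut_powR// ?powR_ge0//; apply: eq_integral => r _; congr EFin.
rewrite /radial_fun /cut_powR !indicE mulrA; congr (_ * _).
rewrite -natrM mulnb; congr (nat_of_bool _)%:R.
have [r0|r0] := ltP 0 r; last first.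
  rewrite memNset/=; last by rewrite itv_posE; apply/negP; rewrite -leNgt.
  by apply/esym; rewrite memNset//= in_itv/= ltNge r0.
rewrite mem_set ?itv_posE//=.
apply/idP/idP; rewrite !inE/= in_itv/= r0/=; move/radial_mean_body_rays; exact.
Qed.

Lemma radial_mean_body_bounded : exists2 E : R, 0 <= E & S `<=` rV_box E.
Proof.
have [D D0 DK] := diff_body_bounded cbK.
exists (n%:R * D); first by rewrite mulr_ge0// ltW.
move=> x Sx i; apply: (le_trans (coord_le_enorm x i)).
have [->|x0] := eqVneq x 0; first by rewrite enorm0 mulr_ge0// ltW.
move: Sx; rewrite radial_mean_bodyE star_ofE// lee_fin => /le_trans; apply.
set u := _ *: x; have u1 : usphere u := usphere_normalize x0.
have nD : 0 <= n%:R * D by rewrite mulr_ge0 ?(ltW D0).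
have -> : n%:R * D = ((n%:R * D) `^ a) `^ a^-1.
  by rewrite -powRrM mulfV ?gt_eqF// powRr1.
rewrite ge0_ler_powR ?invr_ge0 ?(ltW a0)// ?nnegrE ?powR_ge0//.
  exact: radial_mean_body_rhoS_ge0.
rewrite -ler_pdivlMl// -lee_fin -radial_moment_fin//.
exact: radial_moment_covariogram_le (ltW D0) DK _ u1.
Qed.

Lemma vol_radial_mean_body : (vol S)%:E = lam S.
Proof.
have [E E0 SE] := radial_mean_body_bounded.
have := @lebesgue_rV_symbox R n E E0 => e.
rewrite /vol fineK// ge0_fin_numE//.
apply: (@le_lt_trans _ _ (lam (rV_box E))); last by rewrite e ltry.
apply: le_measure => //; rewrite inE; first exact: measurable_radial_mean_body.
exact: measurable_rV_symbox.
Qed.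

End radial_mean_body.

(** The two integrands differ only on the hyperplane [dotp z u = 0], where the power is [0] and the
    exponential [1]; adding the null integral of [dotp_integral_eq0] reconciles them. *)
Lemma integral_dotp_powR q u : q != 0 -> -1 < q -> usphere u ->
  (\int[lam]_z (`|dotp z u| `^ q * cweight K z)%:E =
   (wmean lam (cweight K) (fun z => expR (q * log_dotp u z)))%:E)%E.
Proof.
move=> q0 q1 u1; rewrite EFin_wmean_log_dotp//.
rewrite -[LHS]adde0 -(dotp_integral_eq0 n0 cbK u1) /dotp_integral.
have mpow : measurable_fun setT (fun z : 'rV[R]_n => (`|dotp z u| `^ q)%:E).
  apply/measurable_EFinP; apply: measurable_fun_powR.
  by apply: measurableT_comp => //; exact: measurable_fun_dotp.
rewrite -ge0_integralD//.
- apply: eq_integral => z _; rewrite /log_pow -!EFinM -EFinD -mulrDl; congr ((_ * _)%:E).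
  rewrite /powR normr_eq0 indicE.
  have -> : (dotp z u \in [set 0]) = (dotp z u == 0) by apply/idP/eqP; rewrite inE.
  case: eqP => [->|_]; last by rewrite addr0.
  by rewrite (negbTE q0) add0r normr0 ln0// mulr0 expR0.
- by move=> z _; rewrite lee_fin mulr_ge0 ?powR_ge0// cweight_ge0.
- under eq_fun do rewrite EFinM; apply: emeasurable_funM => //.
  by apply/measurable_EFinP; exact: measurable_cweight.
- by move=> z _; rewrite mule_ge0// lee_fin cweight_ge0.
- have m1 : measurable_fun setT (fun t : R => (\1_[set 0%R] t)%:E : \bar R).
    by apply/measurable_EFinP; exact: measurable_indic.
  exact: (measurable_dotp_integrand cbK u m1).
Qed.

(** Polar coordinates for a [q]-homogeneous function, once with the indicator of the body and once
    with [g_K / vol K]: the radial moments agree. [cweight] carries a further factor [1 / vol K],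
    whence the [vol K] on the right. *)
Lemma integral_dotp_radial_mean_body q u : q != 0 -> -1 < q -> usphere u ->
  \int[lam]_(x in radial_mean_body (n%:R + q) K) (`|dotp x u| `^ q) =
  vol K * wmean lam (cweight K) (fun z => expR (q * log_dotp u z)).
Proof.
move=> q0 q1 u1.
have nq : 0 < n%:R + q.
  have : (1 : R) <= n%:R by rewrite ler1n.
  by lra.
set S := radial_mean_body _ K; have mS : measurable S by exact: measurable_radial_mean_body.
pose f (z : 'rV[R]_n) : R := `|dotp z u| `^ q.
have f0 z : 0 <= f z by exact: powR_ge0.
have mf : measurable_fun setT f.
  apply: measurable_fun_powR.
  by apply: measurableT_comp => //; exact: measurable_fun_dotp.
have f00 : f 0 = 0 by rewrite /f dotp0 normr0 powR0.
have fZ r x : 0 < r -> f (r *: x) = r `^ q * f x.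
  by move=> r0; rewrite /f dotpZl normrM gtr0_norm// powRM// ltW.
have mG : measurable_fun setT (fun z => covariogram K z / vol K).
  by apply: measurable_funM => //; exact: measurable_covariogram.
have G0 z : 0 <= covariogram K z / vol K by rewrite divr_ge0 ?covariogram_ge0// ltW.
have m1 : measurable_fun setT (\1_S : 'rV[R]_n -> R) by exact: measurable_indic.
have i0 (z : 'rV[R]_n) : 0 <= (\1_S z : R) by [].
have E1 := polar_coordinates mf f0 f00 fZ m1 i0.
have E2 := polar_coordinates mf f0 f00 fZ mG G0.
have E : (\int[lam]_x (f x * \1_S x)%:E =
    (vol K)%:E * (wmean lam (cweight K) (fun z => expR (q * log_dotp u z)))%:E)%E.
  transitivity (\int[lam]_x (f x * (covariogram K x / vol K))%:E)%E.
    rewrite E1 E2; congr (_ * _)%E; apply: eq_integral => y _.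
    have [->|y0] := eqVneq y 0; first by rewrite f00 mul0r !mul0e.
    by rewrite radial_moment_indic.
  rewrite -integral_dotp_powR// -ge0_integralZl_EFin//.
  - apply: eq_integral => z _; rewrite -EFinM; congr EFin.
    by rewrite /f /cweight; field; rewrite gt_eqF.
  - by move=> z _; rewrite lee_fin mulr_ge0 ?cweight_ge0.
  - apply/measurable_EFinP; apply: measurable_funM => //.
    exact: measurable_cweight.
  - exact: ltW.
rewrite /Rintegral -EFinM in E *.
rewrite integral_mkcond -[RHS]/(fine (_)%:E) -E; congr fine.
apply: eq_integral => z _; rewrite patchE indicE /f.
by case: ifPn => _; rewrite ?mulr1 ?mulr0.
Qed.

Lemma wmean_log_dotp_gt0 q u : -1 < q -> usphere u ->
  0 < wmean lam (cweight K) (fun z => expR (q * log_dotp u z)).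
Proof.
move=> q1 u1; have [b /(_ u u1) T] := tame_cweight n0 cbK.
exact: (wmean_expR_gt0 T).
Qed.

(** If the body were null, the integral over it would vanish, whereas it is [vol K] times a positive
    mean. *)
Lemma vol_radial_mean_body_gt0 q : q != 0 -> -1 < q ->
  0 < vol (radial_mean_body (n%:R + q) K).
Proof.
move=> q0 q1; have [u u1] := @exists_usphere R n n0.
have nq : 0 < n%:R + q.
  have : (1 : R) <= n%:R by rewrite ler1n.
  by lra.
rewrite lt0r /vol fine_ge0// andbT; apply/eqP => S0.
have := integral_dotp_radial_mean_body q0 q1 u1.
rewrite /Rintegral null_set_integral.
- move=> /esym/eqP; rewrite mulf_eq0 !gt_eqF//.
  exact: wmean_log_dotp_gt0.
- exact: measurable_radial_mean_body.
- apply/measurable_EFinP; apply: measurable_funTS; apply: measurable_fun_powR.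
  by apply: measurableT_comp => //; exact: measurable_fun_dotp.
- by have := vol_radial_mean_body nq; rewrite /vol S0 => /esym.
Qed.

(** For [q != 0] the dilation factor and the average in the centroid body carry opposite powers of
    [vol S], and also of [vol K], so only the mean [M] to the power [- 1 / q] remains. *)
Lemma polar_mean_zonoidE q : -1 < q ->
  polar_mean_zonoid q K = star_of (fun u => (zonoid_radius q u)%:E).
Proof.
move=> q1; rewrite /polar_mean_zonoid /zonoid_radius /log_moment.
have [q00|q0] := eqVneq q 0.
  apply: eq_star_of => u u1; congr (expR (- _))%:E.
  have [b /(_ u u1) T] := tame_cweight n0 cbK.
  have iY := wintegrable_Y T.
  have -> : \int[lam]_z (ln `|dotp u z| * covariogram K z) =
      wmean lam (cweight K) (fun z => vol K ^+ 2 * log_dotp u z).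
    apply: eq_Rintegral => z _; rewrite /cweight /log_dotp dotpC.
    by field; rewrite gt_eqF.
  by rewrite wmeanZ// mulKf// expf_neq0// gt_eqF.
set S := radial_mean_body _ K.
have vS : 0 < vol S := vol_radial_mean_body_gt0 q0 q1.
rewrite /polar_centroid_body scale_star_of; last by rewrite powR_gt0// divr_gt0.
apply: eq_star_of => u u1; congr EFin.
rewrite integral_dotp_radial_mean_body//.
set M := wmean _ _ _; have M0 : 0 < M := wmean_log_dotp_gt0 q1 u1.
rewrite /powR !gt_eqF ?divr_gt0 ?mulr_gt0 ?invr_gt0//.
rewrite -expRD; congr expR.
rewrite !lnM ?posrE ?invr_gt0 ?mulr_gt0// !lnV ?posrE//.
by field.
Qed.

End representation.

(** * Radial functions and the Hausdorff distance *)

Section star_of_radial.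
Context {R : realType} {n : nat}.
Implicit Types (x u : 'rV[R]_n).

Lemma radial_star_of (rho : 'rV[R]_n -> R) u : usphere u -> 0 < rho u ->
  radial (star_of (fun v => (rho v)%:E)) u = (rho u)%:E.
Proof.
move=> u1 r0; apply/eqP; rewrite eq_le; apply/andP; split.
  apply: ge_ereal_sup => _ [t [t0 tu] <-].
  by move: tu; rewrite star_of_ray.
by apply: ereal_sup_ubound; exists (rho u) => //; split => //; rewrite star_of_ray.
Qed.

Lemma le_star_of (rho1 rho2 : 'rV[R]_n -> \bar R) :
  (forall u, usphere u -> (rho1 u <= rho2 u)%E) -> star_of rho1 `<=` star_of rho2.
Proof.
move=> h _ [t [u [u1 t0 tu ->]]]; exists t, u; split => //.
exact: le_trans (h _ u1).
Qed.

Lemma enormBC x y : enorm (x - y) = enorm (y - x).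
Proof. by rewrite -opprB -scaleN1r enormZ normrN1 mul1r. Qed.

(** The nearby point lies on the same ray, cut off at [rho2], so the distance is a difference of
    radii. *)
Lemma star_of_near (rho1 rho2 : 'rV[R]_n -> R) (e : R) :
  (forall u, usphere u -> 0 <= rho2 u) ->
  (forall u, usphere u -> `|rho1 u - rho2 u| <= e) ->
  forall x, star_of (fun u => (rho1 u)%:E) x ->
    exists2 y, star_of (fun u => (rho2 u)%:E) y & enorm (x - y) <= e.
Proof.
move=> r2 h _ [t [u [u1 t0 + ->]]]; rewrite lee_fin => tu.
have e0 : 0 <= e by apply: le_trans (h u u1).
exists (Num.min t (rho2 u) *: u).
  exists (Num.min t (rho2 u)), u; split => //; first by rewrite le_min t0 r2.
  by rewrite lee_fin ge_min lexx orbT.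
rewrite -scalerBl enormZ u1 mulr1.
case: (leP t (rho2 u)) => [_|tr]; first by rewrite subrr normr0.
have /ler_normlP[_ ?] := h u u1.
by rewrite ger0_norm; lra.
Qed.

Lemma hausdorff_dist_star_of (rho1 rho2 : 'rV[R]_n -> R) (e : R) : 0 <= e ->
  (forall u, usphere u -> 0 <= rho1 u) ->
  (forall u, usphere u -> 0 <= rho2 u) ->
  (forall u, usphere u -> `|rho1 u - rho2 u| <= e) ->
  (hausdorff_dist (star_of (fun u => (rho1 u)%:E))
     (star_of (fun u => (rho2 u)%:E)) <= e%:E)%E.
Proof.
move=> e0 r1 r2 h; apply: ereal_inf_lbound; exists e => //; split => //.
- exact: star_of_near.
- move=> y Sy; have [|x Sx xy] := @star_of_near rho2 rho1 e r1 _ y Sy.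
    by move=> u u1; rewrite distrC; exact: h.
  by exists x => //; rewrite enormBC.
Qed.

Lemma hausdorff_dist_ge0 (A B : set 'rV[R]_n) : (0 <= hausdorff_dist A B)%E.
Proof. by apply: le_ereal_inf_tmp => _ [e [e0 _ _] <-]; rewrite lee_fin. Qed.

End star_of_radial.

(** * The inclusions, the two limits and continuity *)

Section polar_mean_zonoids.
Context {R : realType} {n : nat}.
Hypothesis n0 : (0 < n)%N.
Local Notation lam := (rV_lebesgue R n).
Variable K : set 'rV[R]_n.
Hypothesis cbK : convex_body K.
Local Notation w := (cweight K).
Local Notation rho := (zonoid_radius K).
Local Notation L := (fun q u => log_moment lam w (log_dotp u) q).

Let V0 : 0 < vol K. Proof. exact: vol_convex_body_gt0. Qed.

Lemma zonoid_radius_gt0 q u : 0 < rho q u.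
Proof. exact: expR_gt0. Qed.

Lemma zonoid_radius_anti p q u : usphere u -> -1 < p -> p <= q ->
  rho q u <= rho p u.
Proof.
move=> u1 p1 pq; have [b /(_ u u1) T] := tame_cweight n0 cbK.
by rewrite ler_expR lerN2; exact: log_moment_mono T _ _ p1 pq.
Qed.

Lemma radial_polar_mean_zonoid q u : usphere u -> -1 < q ->
  radial (polar_mean_zonoid q K) u = (rho q u)%:E.
Proof.
move=> u1 q1; rewrite polar_mean_zonoidE//.
exact: radial_star_of (zonoid_radius_gt0 q u).
Qed.

(** [g_K] may vanish at [z0] when it is a boundary point; shrinking it by [1 - l] gives the centre
    of a cube on which the density is bounded below. *)
Lemma wmean_indic_gt0 z0 (l e : R) : diff_body K z0 -> 0 < l <= 1 -> 0 < e ->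
  exists2 e' : R, 0 < e' <= e & exists2 m : R, 0 < m &
    m <= wmean lam w \1_[set z | rV_box e' (z - (1 - l) *: z0)].
Proof.
move=> /(diff_bodyP K)[a [b [Ka Kb ->]]] l01 e0.
have [e1 e10 [c c0 gc]] := covariogram_lower cbK Ka Kb l01.
pose e' := Num.min e1 e; have e'0 : 0 < e' by rewrite lt_min e10.
exists e'; first by rewrite e'0 ge_min lexx orbT.
pose m := c / vol K ^+ 2 * (2 * e') ^+ n.
have cV : 0 < c / vol K ^+ 2 by rewrite divr_gt0// exprn_gt0.
exists m; first by rewrite mulr_gt0// exprn_gt0// mulr_gt0.
set p := (1 - l) *: (a - b).
set B := [set z | _].
have mb : measurable (@rV_box R n e') by exact: measurable_rV_symbox.
have mp : measurable_fun setT (fun y : 'rV[R]_n => y - p).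
  exact: measurable_fun_rVB.
have m1 := measurable_fun_indic_comp mb mp.
have mB : measurable_fun setT (\1_B : 'rV[R]_n -> R).
  by apply: measurable_indic; rewrite -[B]setTI; exact: mp.
have mw := measurable_cweight cbK.
have w0 := cweight_ge0 cbK.
have I1 : (\int[lam]_z (\1_B z * w z)%:E <= 1)%E.
  rewrite -(integral_cweight cbK); apply: ge0_le_integral => //.
  - by move=> z _; rewrite lee_fin mulr_ge0.
  - by apply/measurable_EFinP; exact: measurable_funM.
  - exact/measurable_EFinP.
  - by move=> z _; rewrite lee_fin ler_piMl// indicE lern1 leq_b1.
rewrite /wmean /Rintegral -lee_fin fineK; last first.
  rewrite ge0_fin_numE; first by rewrite (le_lt_trans I1)// ltry.
  by apply: integral_ge0 => z _; rewrite lee_fin mulr_ge0.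
rewrite /m EFinM -(lebesgue_rV_symbox n (ltW e'0)).
have -> : lam (rV_box e') = (\int[lam]_x (\1_(rV_box e') (x - p))%:E)%E.
  rewrite (@ge0_integral_rV_translate R n (- p) (fun x => (\1_(rV_box e') x)%:E))//.
    by rewrite integral_indic// setIT.
  by apply/measurable_EFinP; exact: measurable_indic.
rewrite -ge0_integralZl_EFin//; last 2 first.
- exact/measurable_EFinP.
- exact: ltW.
apply: ge0_le_integral => //.
- by move=> z _; rewrite mule_ge0// lee_fin// ltW.
- by apply: measurable_funeM; exact/measurable_EFinP.
- by apply/measurable_EFinP; exact: measurable_funM.
move=> z _; rewrite -EFinM lee_fin.
have -> : \1_B z = \1_(rV_box e') (z - p) :> R.
  by rewrite !indicE; congr (nat_of_bool _)%:R; apply/idP/idP; rewrite !inE.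
rewrite indicE; have [/[!inE] zb|_] := boolP (_ \in _); last by rewrite mulr0 mul0r.
rewrite mulr1 mul1r /cweight ler_wpM2r ?invr_ge0 ?exprn_ge0 ?(ltW V0)//.
by apply: gc => i; apply: (le_trans (zb i)); rewrite ge_min lexx.
Qed.

(** From left to right, the symmetry of the difference body gives [|<z, u>| <= 1 / t] on the
    support, which bounds the moment of exponent [q] by [t^-q]. Conversely, a point [z0] violating
    the bound produces a region of positive mass where [<z, u> >= s' > 1 / t], and large exponents
    detect it. *)
Lemma polar_diff_body_ray u (t : R) : usphere u -> 0 < t ->
  (forall z, diff_body K z -> t * dotp z u <= 1) <->
  (forall q, 0 <= q -> t <= rho q u).
Proof.
move=> u1 t0; have [b /(_ u u1) T] := tame_cweight n0 cbK.
have t_rho q : (t <= rho q u) = (L q u <= - ln t).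
  by rewrite /zonoid_radius -{1}[t]lnK ?posrE// ler_expR lerNr.
split=> [h|h z0 Kz0].
  have sub q : 0 < q -> t <= rho q u.
    move=> q0; have q1 : -1 < q by lra.
    have qn0 : q != 0 by rewrite gt_eqF.
    have tq : 0 < t^-1 `^ q by rewrite powR_gt0// invr_gt0.
    rewrite t_rho /log_moment (negbTE qn0) ler_pdivrMr//.
    rewrite (_ : - ln t * q = ln (t^-1 `^ q)); last by rewrite ln_powR lnV ?posrE// mulrC.
    rewrite ler_ln ?posrE ?(wmean_log_dotp_gt0 n0 cbK)//.
    rewrite -lee_fin -(integral_dotp_powR n0 cbK)//.
    rewrite -[leRHS]mule1 -(integral_cweight cbK).
    have mw := measurable_cweight cbK; have w0 := cweight_ge0 cbK.
    rewrite -ge0_integralZl_EFin//; last 3 first.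
    - by move=> z _; rewrite lee_fin.
    - exact/measurable_EFinP.
    - exact: ltW.
    apply: ge0_le_integral => //.
    - by move=> z _; rewrite lee_fin mulr_ge0// powR_ge0.
    - apply/measurable_EFinP; apply: measurable_funM => //.
      apply: measurable_fun_powR; apply: measurableT_comp => //.
      exact: measurable_fun_dotp.
    - by apply: measurable_funeM; exact/measurable_EFinP.
    move=> z _; rewrite -EFinM lee_fin.
    have [->|wz] := eqVneq (w z) 0; first by rewrite !mulr0.
    rewrite ler_wpM2r// ge0_ler_powR ?(ltW q0)// ?nnegrE ?invr_ge0 ?(ltW t0)//.
    have Kz := cweight_supp wz.
    have KNz : diff_body K (- z).
      have /(diff_bodyP K)[x [y [Kx Ky ->]]] := Kz.
      by apply/diff_bodyP; exists y, x; split => //; rewrite opprB.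
    have h1 := h _ Kz; have h2 := h _ KNz.
    rewrite -scaleN1r dotpZl mulN1r mulrN in h2.
    rewrite -[t^-1]mul1r ler_pdivlMr// mulrC -[t in t * _](gtr0_norm t0) -normrM.
    by apply/ler_normlP; split; lra.
  (* The exponent [0] follows from the exponent [1], as radii are nonincreasing. *)
  move=> q; rewrite le_eqVlt => /predU1P[<-|]; last exact: sub.
  apply: le_trans (sub 1 ltr01) _; apply: zonoid_radius_anti => //; lra.
rewrite leNgt; apply/negP => ts.
set s := dotp z0 u in ts.
have ti : 0 < t^-1 by rewrite invr_gt0.
have st : t^-1 < s by rewrite -[t^-1]mulr1 ltr_pdivrMl.
pose s' := (s + t^-1) / 2.
have s's : s' < s by rewrite /s'; lra.
have s't : t^-1 < s' by rewrite /s'; lra.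
have s0 : 0 < s by lra.
have nR : (0 : R) < n%:R by rewrite ltr0n.
(* The gap [s - s'] is spent in equal halves: [l * s] for shrinking [z0], [n * e] for the variation
   over the cube. *)
pose l := (s - s') / (2 * s).
have ls : l * s = (s - s') / 2 by rewrite /l; field; rewrite gt_eqF.
have l0 : 0 < l by rewrite divr_gt0 ?mulr_gt0//; lra.
have l1 : l <= 1 by rewrite ler_pdivrMr ?mulr_gt0//; lra.
pose e := (s - s') / 2 / n%:R.
have ne : n%:R * e = (s - s') / 2 by rewrite /e mulrC divfK// gt_eqF.
have e0 : 0 < e by rewrite divr_gt0//; lra.
have l01 : 0 < l <= 1 by rewrite l0 l1.
have [e' /andP[e'0 e'e] [m m0 hm]] := wmean_indic_gt0 Kz0 l01 e0.
set B := [set z | _] in hm.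
have mB : measurable B.
  have mb : measurable (@rV_box R n e') by exact: measurable_rV_symbox.
  have mp : measurable_fun setT (fun y : 'rV[R]_n => y - (1 - l) *: z0).
    exact: measurable_fun_rVB.
  by rewrite -[B]setTI; exact: mp.
have low z : w z != 0 -> B z -> ln s' <= log_dotp u z.
  move=> _ Bz; have Bd := norm_dotp_le (ltW e'0) Bz u1.
  have e'n : n%:R * e' <= (s - s') / 2 by rewrite -ne ler_pM2l.
  have zE : dotp z u = (1 - l) * s + dotp (z - (1 - l) *: z0) u.
    rewrite /s -dotpZl /dotp -big_split/=; apply: eq_bigr => i _.
    by rewrite !mxE; ring.
  have zs : s' <= dotp z u.
    by move/ler_normlP : Bd => [d1 d2]; rewrite zE mulrBl mul1r ls; lra.
  rewrite /log_dotp ler_ln ?posrE ?normr_gt0; [|lra|by rewrite gt_eqF//; lra].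
  by rewrite (le_trans zs)// ler_norm.
pose dl := ln s' + ln t.
have dl0 : 0 < dl.
  rewrite /dl -lnM ?posrE//; last by lra.
  by rewrite ln_gt0// -(ltr_pdivrMr _ _ t0) mul1r.
(* Chosen so that [q * dl = |ln m| + 1] exceeds [- ln m], which contradicts the bound that [h] gives
   at this exponent. *)
pose q := (`|ln m| + 1) / dl.
have q0 : 0 < q by rewrite divr_gt0// ltr_wpDl.
have := h q (ltW q0); rewrite t_rho => h1.
have := log_moment_lower_tail T q0 mB low m0 hm => h2.
have : dl <= - (ln m / q) by rewrite /dl; lra.
rewrite -mulNr ler_pdivlMr// /q mulrCA mulfV ?gt_eqF// mulr1.
by have := ler_norm (- ln m); rewrite normrN; lra.
Qed.

(** The truncation [Num.max q 0] gives a function monotone on the whole line, whereas the radii are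
    known to be monotone only for exponents above [-1]; near [+oo] the two agree. *)
Lemma lim_radial_pinfty u : usphere u ->
  lim (radial (polar_mean_zonoid q K) u @[q --> +oo]) =
  ereal_inf (range (fun q => (rho (Num.max q 0) u)%:E)).
Proof.
move=> u1; apply: cvg_lim => //.
have : (rho (Num.max q 0) u)%:E @[q --> +oo] -->
    ereal_inf (range (fun q => (rho (Num.max q 0) u)%:E)).
  apply: nonincreasing_cvge => p q pq; rewrite lee_fin.
  apply: zonoid_radius_anti => //; first by rewrite lt_max ltrN10 orbT.
  by rewrite ge_max le_max pq/= le_max lexx orbT.
apply: cvg_trans; apply: near_eq_cvg; near=> q.
have q0 : 0 <= q by near: q; exact: nbhs_pinfty_ge.
have q1 : -1 < q by apply: lt_le_trans q0; rewrite ltrN10.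
by rewrite radial_polar_mean_zonoid// (max_idPl q0).
Unshelve. all: by end_near. Qed.

Lemma le_lim_radial_pinfty u (t : R) : usphere u ->
  (t%:E <= lim (radial (polar_mean_zonoid q K) u @[q --> +oo%R]))%E <->
  (forall q, 0 <= q -> t <= rho q u).
Proof.
move=> u1; rewrite lim_radial_pinfty//; split=> [h q q0|h].
  rewrite -lee_fin; apply: (le_trans h); apply: ereal_inf_lbound.
  by exists q => //; rewrite (max_idPl q0).
apply: le_ereal_inf_tmp => _ [q _ <-]; rewrite lee_fin; apply: h.
by rewrite le_max lexx orbT.
Qed.

Lemma polar_diff_bodyE : polar (diff_body K) = polar_mean_zonoid_pinfty K.
Proof.
rewrite /polar_mean_zonoid_pinfty; apply/seteqP; split => x.
- move=> px; have [->|x0] := eqVneq x 0.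
    have [u u1] := @exists_usphere R n n0.
    apply: (star_of0 u1); apply/(le_lim_radial_pinfty _ u1) => q _.
    exact/ltW/zonoid_radius_gt0.
  have u1 := usphere_normalize x0.
  have N0 : 0 < enorm x by rewrite enorm_gt0.
  rewrite star_ofE//; apply/le_lim_radial_pinfty => //.
  apply/polar_diff_body_ray => // z Kz.
  by rewrite -dotpZr scalerA mulfV ?gt_eqF// scale1r; exact: px.
- have [->|x0] := eqVneq x 0.
    by move=> _ z _; rewrite dotpC dotp0.
  have u1 := usphere_normalize x0.
  have N0 : 0 < enorm x by rewrite enorm_gt0.
  rewrite star_ofE// => /le_lim_radial_pinfty => /(_ u1) h z Kz.
  have := (polar_diff_body_ray u1 N0).2 h z Kz.
  by rewrite -dotpZr scalerA mulfV ?gt_eqF// scale1r.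
Qed.

Lemma polar_mean_zonoid_pinfty_sub q : -1 < q ->
  polar_mean_zonoid_pinfty K `<=` polar_mean_zonoid q K.
Proof.
move=> q1; rewrite polar_mean_zonoidE//; apply: le_star_of => u u1.
rewrite lim_radial_pinfty//.
apply: (@le_trans _ _ (rho (Num.max q 0) u)%:E).
  by apply: ereal_inf_lbound; exists q.
by rewrite lee_fin zonoid_radius_anti// le_max lexx.
Qed.

Lemma polar_mean_zonoid_anti p q : -1 < p -> p <= q ->
  polar_mean_zonoid q K `<=` polar_mean_zonoid p K.
Proof.
move=> p1 pq; rewrite !polar_mean_zonoidE//; last by lra.
by apply: le_star_of => u u1; rewrite lee_fin zonoid_radius_anti.
Qed.

Lemma wmean_log_dotp_blowup u : usphere u -> exists2 c : R, 0 < c &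
  forall q, -1 < q < 0 ->
    c / (q + 1) <= wmean lam w (fun z => expR (q * log_dotp u z)).
Proof.
move=> u1; have [eta eta0 [c c0 H]] := dotp_integral_lower n0 cbK u1.
(* The integral of [|t|^q] over [[- eta, eta]] is [2 / (q + 1)] times [eta] to the power [q + 1]; as
   [0 < q + 1 < 1], that power is at least [expR (- |ln eta|)] for all [q] at once. *)
exists (2 * c * expR (- `|ln eta|)); first by rewrite !mulr_gt0 ?expR_gt0.
move=> q /andP[q1 q0]; have q10 : 0 < q + 1 by lra.
rewrite -lee_fin (EFin_wmean_log_dotp n0 cbK)//.
apply: le_trans (H _ (measurable_log_pow q) (log_pow_ge0 q)).
have := integral_sym_power q10 (ltW eta0); rewrite addrK => ->.
rewrite -EFinM lee_fin.
have -> : 2 * c * expR (- `|ln eta|) / (q + 1) =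
    c * (2 * ((q + 1)^-1 * expR (- `|ln eta|))) by ring.
rewrite ler_pM2l// ler_pM2l// ler_pM2l ?invr_gt0//.
rewrite /powR gt_eqF// ler_expR.
have := ler_norm (- ln eta); rewrite normrN => h.
have := normr_ge0 (ln eta); nra.
Qed.

(** The radius is the mean to the power [- 1 / q], an exponent above [1] for [-1 < q < 0], so a mean
    of at least [B >= 1] forces a radius of at least [B]. *)
Lemma lim_radial_m1 u : usphere u ->
  lim (radial (polar_mean_zonoid q K) u @[q --> (-1)^'+]) = +oo%E.
Proof.
move=> u1; apply: cvg_lim => //; apply/cvgeyPge => A.
have [c c0 H] := wmean_log_dotp_blowup u1.
pose B := Num.max A 1; have B1 : 1 <= B by rewrite le_max lexx orbT.
have B0 : 0 < B by lra.
near=> q.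
have q1 : -1 < q by near: q; exact: nbhs_right_gt.
have q0 : q < 0 by near: q; apply: nbhs_right_lt; rewrite ltrN10.
have qc : q < -1 + c / B by near: q; apply: nbhs_right_lt; rewrite ltrDl divr_gt0.
rewrite radial_polar_mean_zonoid// lee_fin.
have q10 : 0 < q + 1 by lra.
have MB : B <= wmean lam w (fun z => expR (q * log_dotp u z)).
  apply: le_trans (H q _); last by rewrite q1 q0.
  rewrite ler_pdivlMr// mulrC -ler_pdivlMr//; lra.
apply: (@le_trans _ _ B); first by rewrite le_max lexx.
rewrite /zonoid_radius /log_moment lt_eqF// -[leLHS]lnK ?posrE// ler_expR.
have lB : 0 <= ln B by exact: ln_ge0.
have lM : ln B <= ln (wmean lam w (fun z => expR (q * log_dotp u z))).
  by rewrite ler_ln ?posrE// (lt_le_trans B0).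
rewrite lerNr ler_ndivrMr// mulNr.
by have := mulr_ge0 lB (ltW q10); lra.
Unshelve. all: by end_near. Qed.

Lemma polar_mean_zonoid_m1E : polar_mean_zonoid_m1 K = [set: 'rV[R]_n].
Proof.
apply/seteqP; split => // x _.
have [->|x0] := eqVneq x 0.
  have [u u1] := @exists_usphere R n n0.
  by apply: (star_of0 u1); rewrite lim_radial_m1.
by rewrite /polar_mean_zonoid_m1 star_ofE// lim_radial_m1 ?leey//; exact: usphere_normalize.
Qed.

(** Passing from log-moments to radii through the exponential requires an upper bound on the radii
    uniform in [u], that is, a lower bound on the log-moments. *)
Lemma zonoid_radius_lipschitz p : -1 < p -> exists C dl : R,
  [/\ 0 <= C, 0 < dl & forall q, `|q - p| <= dl -> -1 < q /\
    forall u, usphere u -> `|rho q u - rho p u| <= C * `|q - p|].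
Proof.
move=> p1; have [a a01 H] := log_moment_lipschitz p1.
have [b T] := tame_cweight n0 cbK.
have /andP[a1 a0] := a01.
have [A HA] := wmean_log_dotp_bounded n0 cbK a1.
have [C [dl [dl0 HC]]] := H A b.
(* A second negative exponent, at most [p] as [log_moment_lb] requires; the statement that provides
   [a] does not place it below [p]. *)
pose a' := (Num.min p 0 - 1) / 2.
have mp : Num.min p 0 <= p by rewrite ge_min lexx.
have m0 : Num.min p 0 <= 0 by rewrite ge_min lexx orbT.
have m1 : -1 < Num.min p 0 by rewrite lt_min p1 ltrN10.
have a'01 : -1 < a' < 0 by rewrite /a'; apply/andP; split; lra.
have a'p : a' <= p by rewrite /a'; lra.
have a'1 : -1 < a' by case/andP : a'01.
have [A' HA'] := wmean_log_dotp_bounded n0 cbK a'1.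
(* A common bound for [- L p u] and [- L q u]: the first is at most [- (ln A' / a')], and the second
   differs from it by at most [|C| * dl]. The modulus is there because the sign of [C] is
   unknown. *)
pose B := `|C| * dl - ln A' / a'.
exists (`|C| * (2 * expR B)), dl; split => //.
(* Some direction is required because [-1 < q] is claimed outside the quantifier over [u]. *)
move=> q qp; have [u0 u01] := @exists_usphere R n n0.
split; first by have [] := HC _ _ _ _ _ (T _ u01) (HA _ u01) q qp.
move=> u u1; have [q1 hq] := HC _ _ _ _ _ (T _ u1) (HA _ u1) q qp.
have lb := log_moment_lb (T _ u1) a'01 a'p (HA' _ u1).
have hq' : `|L q u - L p u| <= `|C| * `|q - p|.
  by apply: (le_trans hq); rewrite ler_wpM2r// ler_norm.
have Cdl : `|C| * `|q - p| <= `|C| * dl by rewrite ler_wpM2l.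
have C0 : 0 <= `|C| * dl by rewrite mulr_ge0// ltW.
apply: (le_trans (norm_expRB _ _)).
have -> : `|- L q u - - L p u| = `|L q u - L p u|.
  by rewrite opprK addrC distrC.
have e1 : expR (- L q u) <= expR B.
  by rewrite ler_expR /B; move/ler_normlP : (le_trans hq' Cdl) => [d1 d2]; lra.
have e2 : expR (- L p u) <= expR B by rewrite ler_expR /B; lra.
have -> : `|C| * (2 * expR B) * `|q - p| = `|C| * `|q - p| * (2 * expR B) by ring.
apply: ler_pM => //; lra.
Qed.

Lemma hausdorff_dist_polar_mean_zonoid p : -1 < p ->
  hausdorff_dist (polar_mean_zonoid q K) (polar_mean_zonoid p K)
    @[q --> p] --> 0%E.
Proof.
move=> p1; have [C [dl [C0 dl0 H]]] := zonoid_radius_lipschitz p1.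
apply: (@squeeze_cvge _ _ _ _ (cst 0%E) _ (fun q => (C * `|q - p|)%:E)).
- near=> q; rewrite hausdorff_dist_ge0/=.
  have qp : `|q - p| <= dl.
    by rewrite distrC; near: q; apply: cvgr_dist_le.
  have [q1 h] := H q qp.
  rewrite !polar_mean_zonoidE//; apply: hausdorff_dist_star_of.
  + by rewrite mulr_ge0.
  + by move=> u _; exact/ltW/zonoid_radius_gt0.
  + by move=> u _; exact/ltW/zonoid_radius_gt0.
  + exact: h.
- exact: cvg_cst.
- apply: cvg_EFin; first exact: nearW.
  rewrite -[X in _ --> X](mulr0 C); apply: cvgM; first exact: cvg_cst.
  have c : (q - p) @[q --> p] --> p - p by apply: cvgB; [exact: cvg_id|exact: cvg_cst].
  have := cvg_norm c; rewrite subrr normr0; exact.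
Unshelve. all: by end_near. Qed.

End polar_mean_zonoids.

Unset Implicit Arguments.

Theorem proposition10 (R : realType) (n : nat) (n_gt0 : (0 < n)%N)
    (K : set 'rV[R]_n) (cbK : convex_body K) :
  (forall p q : R, -1 < p -> p < q ->
     [/\ polar (diff_body K) = polar_mean_zonoid_pinfty K,
         polar_mean_zonoid_pinfty K `<=` polar_mean_zonoid q K,
         polar_mean_zonoid q K `<=` polar_mean_zonoid p K,
         polar_mean_zonoid p K `<=` polar_mean_zonoid_m1 K
       & polar_mean_zonoid_m1 K = [set: 'rV[R]_n]]) /\
  (forall p : R, -1 < p ->
     hausdorff_dist (polar_mean_zonoid q K) (polar_mean_zonoid p K)
       @[q --> p] --> 0%E).
Proof.
split=> [p q p1 pq|]; last exact: hausdorff_dist_polar_mean_zonoid.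
have q1 : -1 < q by exact: lt_trans pq.
split.
- exact: polar_diff_bodyE.
- exact: polar_mean_zonoid_pinfty_sub.
- by apply: polar_mean_zonoid_anti => //; exact: ltW.
- by rewrite polar_mean_zonoid_m1E.
- exact: polar_mean_zonoid_m1E.
Qed.
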